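(* Let $\varphi\in\tilde{\Phi}_2$ or $\varphi\in\tilde{\Psi}_2$, and let $F_{\varphi}:(0,\infty)^2\to(0,\infty)$ be $F_{\varphi}(x_1,x_2)=\varphi(x_1^{-1/n},x_2^{-1/n})$. (i) If $F_{\varphi}$ is convex, then for all $K,L\in\mathcal{S}_0$, $$\varphi\bigg(\bigg(\frac{|K\widetilde{+}_{\varphi}L|}{|K|}\bigg)^{1/n},\bigg(\frac{|K\widetilde{+}_{\varphi}L|}{|L|}\bigg)^{1/n}\bigg)\le 1.$$ If in addition $F_{\varphi}$ is strictly convex, equality holds if and only if $K$ and $L$ are dilates of each other. (ii) If $F_{\varphi}$ is concave, then for all $K,L\in\mathcal{S}_0$, $$\varphi\bigg(\bigg(\frac{|K\widetilde{+}_{\varphi}L|}{|K|}\bigg)^{1/n},\bigg(\frac{|K\widetilde{+}_{\varphi}L|}{|L|}\bigg)^{1/n}\bigg)\ge 1.$$ If in addition $F_{\varphi}$ is strictly concave, equality holds if and only if $K$ and $L$ are dilates of each other.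
   Context: Fix a positive integer $n$. A star body (about the origin) is a set $K\subset\mathbb{R}^n$ that contains the segment from the origin to each of its points and whose radial function $\rho_K(u)=\max\{\lambda:\lambda u\in K\}$, $u\in S^{n-1}$, is continuous and positive on $S^{n-1}$. $\mathcal{S}_0$ is the set of all star bodies; a star body is uniquely determined by its (continuous positive) radial function and vice versa. $K,L\in\mathcal{S}_0$ are dilates of each other if $L=\lambda K$ for some constant $\lambda>0$. $|K|$ denotes volume. $\tilde{\Phi}_m$ is the set of functions $\varphi:[0,\infty)^m\to[0,\infty)$ that are continuous, strictly increasing in each variable, with $\varphi(0)=0$ and $\varphi(e_i)=1$ for each standard basis vector $e_i$ of $\mathbb{R}^m$. $\tilde{\Psi}_m$ is the set of functions $\varphi:(0,\infty)^m\to(0,\infty)$ such that $\tilde{\varphi}(x_1,\dots,x_m)=\varphi(1/x_1,\dots,1/x_m)$ belongs to $\tilde{\Phi}_m$ (i.e. extends continuously from $(0,\infty)^m$ to $[0,\infty)^m$ as an element of $\tilde{\Phi}_m$). For $\varphi\in\tilde{\Phi}_2$ or $\varphi\in\tilde{\Psi}_2$ and $K,L\in\mathcal{S}_0$, the Orlicz $\varphi$-radial addition $K\widetilde{+}_{\varphi}L\in\mathcal{S}_0$ is the star body whose radial function is uniquely determined by $$\varphi\bigg(\frac{\rho_{K\widetilde{+}_{\varphi}L}(u)}{\rho_K(u)},\frac{\rho_{K\widetilde{+}_{\varphi}L}(u)}{\rho_L(u)}\bigg)=1\quad\text{for all }u\in S^{n-1}.$$ *)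

(* Defs.v *)
From HB Require Import structures.
From mathcomp Require Import all_boot all_order all_algebra.
From mathcomp Require Import all_classical all_reals all_analysis.

Set Implicit Arguments.
Unset Strict Implicit.
Unset Printing Implicit Defensive.

Import Order.TTheory GRing.Theory Num.Theory.
Import numFieldNormedType.Exports.

Local Open Scope classical_set_scope.
Local Open Scope ring_scope.
Local Open Scope convex_scope.

(* Lebesgue measure on n.-tuple R is the n-fold product of the one-dimensional
   Lebesgue measure: the product measure on R * n.-tuple R is transported to
   n.+1.-tuple R along (x, t) |-> x :: t.  The sigma-algebra is the library's
   one on tuples, generated by the coordinates. *)
Section lebesgue_step.
Context {R : realType} (n : nat).
Local Notation mR := (measurableTypeR R).
Variable m : {sigma_finite_measure set (n.-tuple mR) -> \bar R}.

Definition tuple_cons (p : mR * n.-tuple mR) : n.+1.-tuple mR :=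
  [the n.+1.-tuple mR of p.1 :: p.2].

Lemma measurable_tuple_cons : measurable_fun [set: mR * n.-tuple mR] tuple_cons.
Proof. exact: measurable_cons. Qed.

Definition lebesgue_step : set (n.+1.-tuple mR) -> \bar R :=
  pushforward (lebesgue_measure \x m)%E tuple_cons.

Let lebesgue_step0 : lebesgue_step set0 = 0%E.
Proof. by rewrite /lebesgue_step /pushforward preimage_set0 measure0. Qed.

Let lebesgue_step_ge0 A : (0 <= lebesgue_step A)%E.
Proof. by rewrite /lebesgue_step /pushforward; exact: measure_ge0. Qed.

Let lebesgue_step_sigma_additive : semi_sigma_additive lebesgue_step.
Proof.
move=> F mF tF mUF; rewrite /lebesgue_step /pushforward preimage_bigcup.
apply: measure_semi_sigma_additive.
- by move=> k; rewrite -[X in measurable X]setTI; exact: measurable_tuple_cons.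
- apply/trivIsetP => /= i j _ _ ij; rewrite -preimage_setI.
  by move/trivIsetP : tF => /(_ _ _ _ _ ij) ->//; rewrite preimage_set0.
- rewrite -preimage_bigcup -[X in measurable X]setTI.
  exact: measurable_tuple_cons.
Qed.

HB.instance Definition _ := isMeasure.Build _ _ _ lebesgue_step
  lebesgue_step0 lebesgue_step_ge0 lebesgue_step_sigma_additive.

Let measurable_uncons : measurable_fun [set: n.+1.-tuple mR]
  (fun t : n.+1.-tuple mR => (thead t, [tuple of behead t])).
Proof.
apply/measurable_fun_pairP; split => /=.
  exact: measurable_tnth.
exact: measurable_behead.
Qed.

Let tuple_consK : cancel tuple_cons
  (fun t : n.+1.-tuple mR => (thead t, [tuple of behead t])).
Proof. by move=> [x t] /=; congr pair; apply/val_inj. Qed.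

Let lebesgue_step_sigma_finite : sigma_finite setT lebesgue_step.
Proof.
have [F TF Ffin] : sigma_finite setT (lebesgue_measure \x m)%E.
  have /sigma_finiteP[F [TF ndF Foo]] := sigma_finiteT (@lebesgue_measure R).
  have /sigma_finiteP[G [TG ndG Goo]] := sigma_finiteT m.
  exists (fun k => F k `*` G k).
    rewrite -setXTT TF TG predeqE => -[x y]; split.
      move=> [/= [i _ Fx] [k _ Gy]]; exists (maxn i k) => //; split.
      - by move: x Fx; exact/subsetPset/ndF/leq_maxl.
      - by move: y Gy; exact/subsetPset/ndG/leq_maxr.
    by move=> [k _ []/= ? ?]; split; exists k.
  move=> k; have [? ?] := Foo k; have [? ?] := Goo k.
  split; first exact: measurableX.
  by rewrite product_measure1E// lte_mul_pinfty// ge0_fin_numE.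
exists (fun k => (fun t : n.+1.-tuple mR =>
    (thead t, [tuple of behead t])) @^-1` F k).
  by rewrite -preimage_bigcup -TF.
move=> k; have [mF Fk] := Ffin k; split.
  by rewrite -[X in measurable X]setTI; exact: measurable_uncons.
rewrite /lebesgue_step /pushforward.
rewrite (_ : _ @^-1` _ = F k)//; apply/seteqP.
by split => p /=; rewrite tuple_consK.
Qed.

HB.instance Definition _ := Measure_isSigmaFinite.Build _ _ _ lebesgue_step
  lebesgue_step_sigma_finite.

Lemma lebesgue_stepX (A : set mR) (B : set (n.-tuple mR)) :
  measurable A -> measurable B ->
  lebesgue_step [set t | A (thead t) /\ B [tuple of behead t]] =
  (lebesgue_measure A * m B)%E.
Proof.
move=> mA mB; rewrite -product_measure1E//.
rewrite /lebesgue_step /pushforward; congr (_ _).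
apply/seteqP; split => -[x t] /=;
  by rewrite (_ : [tuple of _] = t) //; apply/val_inj.
Qed.
End lebesgue_step.

Fixpoint lebesgue_tuple {R : realType} (n : nat) :
    {sigma_finite_measure set (n.-tuple (measurableTypeR R)) -> \bar R} :=
  if n is k.+1 then lebesgue_step (lebesgue_tuple k)
  else dirac [tuple].

Lemma lebesgue_tuple_box {R : realType} (n : nat)
    (A : 'I_n -> set (measurableTypeR R)) :
  (forall i, measurable (A i)) ->
  lebesgue_tuple n [set t | forall i, A i (tnth t i)] =
  (\prod_(i < n) lebesgue_measure (A i))%E.
Proof.
elim: n A => [|n IH] A mA.
  rewrite big_ord0 /= diracE mem_set// => -[] //.
rewrite big_ord_recl -IH; last by move=> i; exact: mA.
rewrite -lebesgue_stepX //=; last first.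
  have -> : [set t : n.-tuple (measurableTypeR R) |
      forall i, A (lift ord0 i) (tnth t i)] =
      \bigcap_(i in [set: 'I_n]) ((@tnth _ _)^~ i @^-1` A (lift ord0 i)).
    by apply/seteqP; split => t /= H i; [move=> _; exact: H|exact: H].
  apply: fin_bigcap_measurable => // i _.
  by rewrite -[X in measurable X]setTI; exact: measurable_tnth.
congr lebesgue_step; apply/seteqP; split => t /=.
  move=> H; split; first exact: H.
  move=> i; have := H (lift ord0 i).
  by rewrite [t in tnth t (lift _ _)]tuple_eta tnthS.
move=> [H0 H] i; have [j ->|->//] := unliftP ord0 i.
by have := H j; rewrite [t in tnth t (lift _ _)]tuple_eta tnthS.
Qed.

Section euclidean.
Context {R : realType} (n : nat).
Implicit Types (K L : set 'rV[R]_n) (u : 'rV[R]_n).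

(* The library norm `|x| on row vectors is the sup norm. *)
Definition enorm u : R := Num.sqrt (\sum_i u ord0 i ^+ 2).

Definition unit_sphere : set 'rV[R]_n := [set u | enorm u = 1].

Definition volume K : R :=
  fine (lebesgue_tuple n [set t | K (\row_i tnth t i)]).

Definition ray K u : set R := [set l | K (l *: u)].

(* [sup] is 0 on sets without supremum; that the maximum exists is part of
   [star_body]. *)
Definition radial K u : R := sup (ray K u).

Definition star_body K : Prop :=
  [/\ forall x, K x -> forall t : R, 0 <= t <= 1 -> K (t *: x),
      forall u, unit_sphere u ->
        ray K u (radial K u) /\ ubound (ray K u) (radial K u),
      {within unit_sphere, continuous (radial K)} &
      forall u, unit_sphere u -> 0 < radial K u].

Definition dilates K L : Prop :=
  exists2 l : R, 0 < l & L = [set l *: x | x in K].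

End euclidean.

Section orlicz_functions.
Context {R : realType} (m : nat).
Implicit Types (phi : 'rV[R]_m -> R) (x y : 'rV[R]_m).

Definition nonneg_orthant : set 'rV[R]_m := [set x | forall i, 0 <= x ord0 i].

Definition pos_orthant : set 'rV[R]_m := [set x | forall i, 0 < x ord0 i].

(* Functions on [0,oo)^m or (0,oo)^m are total functions on R^m of which only
   the values on the orthant are constrained and used. *)
Definition Phi_class phi : Prop :=
  [/\ forall x, nonneg_orthant x -> 0 <= phi x,
      {within nonneg_orthant, continuous phi},
      forall x y i, nonneg_orthant x -> nonneg_orthant y ->
        (forall j, j != i -> x ord0 j = y ord0 j) ->
        x ord0 i < y ord0 i -> phi x < phi y,
      phi 0 = 0 &
      forall i, phi (delta_mx ord0 i) = 1].

Definition Psi_class phi : Prop :=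
  (forall x, pos_orthant x -> 0 < phi x) /\
  exists2 psi, Phi_class psi &
    forall x, pos_orthant x -> psi x = phi (map_mx GRing.inv x).

End orlicz_functions.

Definition vec2 {R : realType} (a b : R) : 'rV[R]_2 :=
  \row_i (if i == ord0 then a else b).

Definition is_orlicz_radial_sum {R : realType} (n : nat) (phi : 'rV[R]_2 -> R)
    (K L M : set 'rV[R]_n) : Prop :=
  star_body M /\
  forall u, unit_sphere u ->
    phi (vec2 (radial M u / radial K u) (radial M u / radial L u)) = 1.

(* The star body singled out by [is_orlicz_radial_sum]; the default [set0] is
   only reached when there is none. *)
Definition orlicz_radial_sum {R : realType} (n : nat) (phi : 'rV[R]_2 -> R)
    (K L : set 'rV[R]_n) : set 'rV[R]_n :=
  xget set0 [set M | is_orlicz_radial_sum phi K L M].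

Definition F_of {R : realType} (n : nat) (phi : 'rV[R]_2 -> R)
    (x : 'rV[R]_2) : R :=
  phi (vec2 (x ord0 0 `^ (- n%:R^-1)) (x ord0 1 `^ (- n%:R^-1))).

Section convexity.
Context {R : realType} {E : lmodType R}.
Implicit Types (D : set (convex_lmodType E)) (f : convex_lmodType E -> R^o).

Definition strictly_convex_function D f : Prop :=
  forall t : {i01 R}, 0 < t%:num < 1 ->
    {in D &, forall x y, x != y -> f (x <| t |> y) < f x <| t |> f y}.

Definition concave_function D f : Prop :=
  forall t : {i01 R}, {in D &, forall x y, f x <| t |> f y <= f (x <| t |> y)}.

Definition strictly_concave_function D f : Prop :=
  forall t : {i01 R}, 0 < t%:num < 1 ->
    {in D &, forall x y, x != y -> f x <| t |> f y < f (x <| t |> y)}.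

End convexity.

(* Main.v *)
Require Import Defs.
From HB Require Import structures.
From mathcomp Require Import all_boot all_order all_algebra.
From mathcomp Require Import all_classical all_reals all_analysis.
From mathcomp Require Import measurable_realfun ring lra.

Set Implicit Arguments.
Unset Strict Implicit.
Unset Printing Implicit Defensive.

Import Order.TTheory GRing.Theory Num.Theory.
Import numFieldNormedType.Exports.

Local Open Scope classical_set_scope.
Local Open Scope ring_scope.

(** Polar coordinates are not needed.  For star bodies K and M, put
    [ratio K M x = (rho_K / rho_M)^n] in the direction of x.  If
    [a <= ratio K M <= b] on a measurable cone C, then the dilates
    [a^(1/n) (M & C)] and [b^(1/n) (M & C)] enclose [K & C], so
    [a |M & C| <= |K & C| <= b |M & C|].  Cutting space into finitely many
    cones on which [ratio K M] and [ratio L M] are almost constant turns a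
    pointwise inequality [al * ratio K M + be * ratio L M <= ga] into
    [al |K| + be |L| <= ga |M|].  When M is the Orlicz sum of K and L, the
    point (ratio K M, ratio L M) stays on the level set {F = 1}; the linear
    inequality given by a supporting plane of F at (|K|/|M|, |L|/|M|) then
    yields F(|K|/|M|, |L|/|M|) <= 1.  If F is strictly convex and the ratios
    are not constant, the linear inequality is strict on an open cone, which
    has positive volume, so equality fails. *)

(** * Lebesgue measure under dilation *)

Section scaling.
Context {R : realType}.
Local Notation mR := (measurableTypeR R).

(** Packages a multiple of an image measure as a bundled measure, so that the uniqueness theorems
    for Lebesgue and product measures apply to it. *)
Lemma exists_scaled_pushforward d1 d2 (T1 : measurableType d1)
    (T2 : measurableType d2) (r : R) (m : {measure set T1 -> \bar R})
    (f : T1 -> T2) : 0 <= r -> measurable_fun setT f ->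
  exists m' : {measure set T2 -> \bar R},
    forall A, m' A = (r%:E * m (f @^-1` A))%E.
Proof.
move=> r0 mf; pose pf : {measure set T2 -> \bar R} :=
  measure_function_pushforward__canonical__measure_function_Measure m mf.
by exists (mscale (NngNum r0) pf).
Qed.

(** Both sides are measures in [A] that agree on half-open intervals. *)
Lemma lebesgue_measure_scale (s : R) (A : set mR) : 0 < s -> measurable A ->
  (s%:E * lebesgue_measure (( *%R s) @^-1` A) = lebesgue_measure A)%E.
Proof.
move=> s0 mA.
have ms : measurable_fun [set: mR] ( *%R s : mR -> mR).
  exact: mulrl_measurable.
have [m mE] := exists_scaled_pushforward lebesgue_measure (ltW s0) ms.
rewrite -mE; apply/esym/lebesgue_measure_unique => //.
move=> _ [[a b] _ <-]; rewrite mE /=.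
have -> : *%R s @^-1` `]a, b] = `](a / s), (b / s)]%classic.
  apply/seteqP; split => x /=; rewrite !in_itv /=;
    by rewrite ltr_pdivrMr // ler_pdivlMr // mulrC.
rewrite !lebesgue_measure_itv /= !lte_fin ltr_pM2r ?invr_gt0 //.
case: ifPn => _; last by rewrite mule0.
by rewrite -!EFinB -EFinM -mulrBl mulrCA divff ?mulr1 // gt_eqF.
Qed.

Definition scale_tuple n (s : R) (t : n.-tuple mR) : n.-tuple mR :=
  [tuple of map ( *%R s) t].

Lemma measurable_scale_tuple n s : measurable_fun setT (@scale_tuple n s).
Proof.
apply/measurable_fun_tnthP => i /=.
rewrite (_ : _ \o _ = ( *%R s) \o (@tnth _ mR ^~ i)); last first.
  by apply/funext => t /=; rewrite tnth_map.
apply: measurableT_comp; last exact: measurable_tnth.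
exact: mulrl_measurable.
Qed.

(** By induction on the dimension: [s ^+ n.+1] times the image of the product measure under dilation
    has the right value on rectangles, and a product measure is determined by those. *)
Lemma lebesgue_tuple_scale n (s : R) (A : set (n.-tuple mR)) :
  0 < s -> measurable A ->
  ((s ^+ n)%:E * lebesgue_tuple n (@scale_tuple n s @^-1` A)
   = lebesgue_tuple n A)%E.
Proof.
move=> s0; elim: n A => [|n IH] A mA.
  rewrite expr0 mul1e; congr (_ _).
  by apply/seteqP; split => t /=; rewrite !(tuple0 (scale_tuple _ _), tuple0 t).
have ms : measurable_fun setT
    (fun p : mR * n.-tuple mR => (s * p.1 : mR, scale_tuple s p.2)).
  apply/measurable_fun_pairP; split => /=.
    have ms1 : measurable_fun [set: mR] ( *%R s : mR -> mR).
      exact: mulrl_measurable.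
    exact: (measurableT_comp ms1 (@measurable_fst _ _ mR (n.-tuple mR))).
  exact: (measurableT_comp (@measurable_scale_tuple n s)
            (@measurable_snd _ _ mR (n.-tuple mR))).
have [m mE] := exists_scaled_pushforward
  (lebesgue_measure \x lebesgue_tuple n)%E (exprn_ge0 n.+1 (ltW s0)) ms.
rewrite /= /lebesgue_step /pushforward.
rewrite [RHS](product_measure_unique (m' := m)).
- rewrite mE; congr (_ * _)%E; congr (product_measure1 _ _ _).
  apply/seteqP; split => -[x t] /=;
    by rewrite (_ : scale_tuple _ _ = tuple_cons (s * x, scale_tuple s t)) //;
    apply/val_inj.
- move=> B C mB mC; rewrite mE.
  transitivity ((s ^+ n.+1)%:E * (lebesgue_measure \x lebesgue_tuple n)
      ((( *%R s : mR -> mR) @^-1` B) `*` (@scale_tuple n s @^-1` C)))%E => //.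
  rewrite product_measure1E /=.
  + rewrite -(lebesgue_measure_scale s0 mB) -(IH _ mC) exprS EFinM.
    by rewrite muleACA.
  + by rewrite -[X in measurable X]setTI; exact: mulrl_measurable.
  + by rewrite -[X in measurable X]setTI; exact: measurable_scale_tuple.
- by rewrite -[X in measurable X]setTI; exact: measurable_tuple_cons.
Qed.

End scaling.

(** * Volumes of sets of row vectors *)

Lemma rV_ballP (R : realType) n (x y : 'rV[R]_n) (e : R) : 0 < e ->
  ball x e y <-> forall i, `|x ord0 i - y ord0 i| < e.
Proof.
move=> e0; split => [[_ H] i|H]; first by have := H ord0 i; rewrite -ball_normE.
by split => // i j; rewrite (ord1 i) -ball_normE; exact: H.
Qed.

Section volume_measure.
Context {R : realType} (n : nat).
Local Notation mR := (measurableTypeR R).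
Implicit Types (A B : set 'rV[R]_n) (x : 'rV[R]_n).

(** The measure and its coordinate sigma-algebra live on tuples, so sets of row vectors are
    transported there. *)
Definition row_preim A : set (n.-tuple mR) := [set t | A (\row_i tnth t i)].
Definition vmeas A := measurable (row_preim A).
Definition vfin A := vmeas A /\ (lebesgue_tuple n (row_preim A) < +oo)%E.

Lemma vmeasI A B : vmeas A -> vmeas B -> vmeas (A `&` B).
Proof. exact: measurableI. Qed.

Lemma vmeasC A : vmeas A -> vmeas (~` A).
Proof. exact: measurableC. Qed.

Lemma vmeasD A B : vmeas A -> vmeas B -> vmeas (A `\` B).
Proof. exact: measurableD. Qed.

Lemma vmeas_box (D : 'I_n -> set R) :
  (forall i, measurable (D i : set mR)) ->
  vmeas [set x : 'rV[R]_n | forall i, D i (x ord0 i)].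
Proof.
move=> mD; rewrite /vmeas.
have -> : row_preim [set x : 'rV[R]_n | forall i, D i (x ord0 i)] =
    \bigcap_(i in [set: 'I_n]) ((@tnth n mR)^~ i @^-1` D i).
  apply/seteqP; split => t /= H i; first by move=> _; have := H i; rewrite mxE.
  by rewrite mxE; exact: H.
apply: fin_bigcap_measurable => // i _.
by rewrite -[X in measurable X]setTI; exact: measurable_tnth.
Qed.

Lemma lebesgue_tuple_row_box (D : 'I_n -> set mR) :
  (forall i, measurable (D i)) ->
  lebesgue_tuple n (row_preim [set x : 'rV[R]_n | forall i, D i (x ord0 i)]) =
  (\prod_(i < n) lebesgue_measure (D i))%E.
Proof.
move=> mD; rewrite -(lebesgue_tuple_box mD); congr (_ _).
by apply/seteqP; split => t /= H i; have := H i; rewrite mxE.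
Qed.

(** The sigma-algebra is generated by coordinates, so an open set is written as the countable union
    of the boxes with rational centre and radius 1/(k+1) that it contains. *)
Lemma open_vmeas A : open A -> vmeas A.
Proof.
move=> oA.
pose box (q : n.-tuple rat * nat) : set 'rV[R]_n := [set x | forall i,
  x ord0 i \in `]ratr (tnth q.1 i) - q.2.+1%:R^-1,
                 ratr (tnth q.1 i) + q.2.+1%:R^-1[].
pose D q := if `[< box q `<=` A >] then box q else set0.
have AE : A = \bigcup_q D q.
  apply/seteqP; split => [x Ax|x [q _]]; last first.
    by rewrite /D; case: asboolP => // qA xq; exact: qA.
  have /nbhs_ballP[e /= e0 eA] : nbhs x A by exact: open_nbhs_nbhs.
  (* If the rational centre is within 1/(k+1) of x in each coordinate, every point of its box is
     within 2/(k+1) < e of x. *)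
  have [k ke] : exists k : nat, k.+1%:R^-1 < e / 2.
    by have /ltr_add_invr[k] : 0 < e / 2; [rewrite divr_gt0|
      rewrite add0r => ?; exists k].
  have k0 : 0 < k.+1%:R^-1 :> R by rewrite invr_gt0.
  have qE i : exists q : rat,
      ratr q \in `](x ord0 i - k.+1%:R^-1), (x ord0 i + k.+1%:R^-1)[.
    by apply: rat_in_itvoo; rewrite ltrD2l gtrN.
  pose q := [tuple projT1 (cid (qE i)) | i < n].
  have qP i : x ord0 i - k.+1%:R^-1 < ratr (tnth q i) < x ord0 i + k.+1%:R^-1.
    by rewrite tnth_mktuple; case: cid => r /=; rewrite in_itv.
  have xq : box (q, k) x.
    by move=> i; rewrite in_itv /=; have := qP i; set d := _^-1; lra.
  exists (q, k) => //; rewrite /D asboolT // => y yq; apply: eA.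
  apply/rV_ballP => // j; rewrite ltr_norml.
  have := yq j; have := qP j; rewrite in_itv /=.
  by move: ke; set d := _^-1; lra.
rewrite /vmeas AE (_ : row_preim _ = \bigcup_q row_preim (D q)); last first.
  by apply/seteqP; split => t /= [q]; exists q.
apply: countable_bigcupT_measurable => [|q]; first exact: countableP.
rewrite /D; case: asboolP => _; last exact: measurable0.
by apply: (@vmeas_box (fun i => [set` `]ratr (tnth q.1 i) - q.2.+1%:R^-1,
  ratr (tnth q.1 i) + q.2.+1%:R^-1[])) => i; exact: measurable_itv.
Qed.

Lemma closed_vmeas A : closed A -> vmeas A.
Proof.
by move=> cA; rewrite -[A]setCK; apply: vmeasC; apply: open_vmeas;
  exact: closed_openC.
Qed.

Lemma vfinS A B : vmeas A -> vfin B -> A `<=` B -> vfin A.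
Proof.
move=> mA [mB Boo] AB; split => //; apply: le_lt_trans Boo.
by apply: le_measure; rewrite ?inE // => t; exact: AB.
Qed.

Lemma vfinI A B : vfin A -> vmeas B -> vfin (A `&` B).
Proof.
by move=> fA mB; apply: vfinS (fA) _; [case: fA => *; exact: vmeasI|].
Qed.

Lemma vfinD A B : vfin A -> vmeas B -> vfin (A `\` B).
Proof. by move=> fA mB; rewrite setDE; apply: vfinI => //; exact: vmeasC. Qed.

Lemma volumeK A : vfin A -> (volume A)%:E = lebesgue_tuple n (row_preim A).
Proof. by move=> [mA Aoo]; rewrite /volume fineK // ge0_fin_numE. Qed.

Lemma volume_ge0 A : 0 <= volume A.
Proof. by rewrite /volume fine_ge0. Qed.

Lemma le_volume A B : vmeas A -> vfin B -> A `<=` B -> volume A <= volume B.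
Proof.
move=> mA fB AB; have fA := vfinS mA fB AB; case: (fB) => mB _.
rewrite -lee_fin !volumeK //; apply: le_measure; rewrite ?inE // => t.
exact: AB.
Qed.

Lemma volumeDI A B : vfin A -> vmeas B ->
  volume A = volume (A `\` B) + volume (A `&` B).
Proof.
move=> fA mB; case: (fA) => mA _; apply: EFin_inj; rewrite EFinD !volumeK //.
- by rewrite (measureDI _ mA mB).
- exact: vfinI.
- exact: vfinD.
Qed.

Lemma vmeas_scale (s : R) A : vmeas A -> vmeas [set x | A (s *: x)].
Proof.
move=> mA; rewrite /vmeas (_ : row_preim _ = scale_tuple s @^-1` row_preim A).
  by rewrite -[X in measurable X]setTI; exact: measurable_scale_tuple.
by apply/seteqP; split => t /=; congr A; apply/rowP => i;
  rewrite !mxE tnth_map.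
Qed.

Lemma volume_scale (s : R) A : 0 < s -> vmeas A ->
  s ^+ n * volume [set x | A (s *: x)] = volume A.
Proof.
move=> s0 mA; rewrite /volume -[in RHS](lebesgue_tuple_scale s0 mA).
have sn0 : 0 < s ^+ n by exact: exprn_gt0.
rewrite (_ : scale_tuple s @^-1` _ = row_preim [set x | A (s *: x)]); last first.
  by apply/seteqP; split => t /=; congr A; apply/rowP => i;
    rewrite !mxE tnth_map.
(* At infinite measure [fine] makes both sides 0, so the identity holds without a finiteness
   assumption. *)
rewrite /row_preim /=; case: (lebesgue_tuple n _) => [r||] //=.
  by rewrite gt0_muley ?lte_fin // mulr0.
by rewrite gt0_muleNy ?lte_fin // mulr0.
Qed.

Lemma vfin_bounded (r : R) A : vmeas A ->
  (forall x, A x -> forall i, `|x ord0 i| <= r) -> vfin A.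
Proof.
move=> mA Ar.
apply: (@vfinS _ [set x : 'rV[R]_n | forall i, `[-r, r]%classic (x ord0 i)])
  => //; last first.
  by move=> x /Ar xr i; rewrite /= in_itv /= -ler_norml.
split.
  by apply: (@vmeas_box (fun=> `[-r, r]%classic)) => i; exact: measurable_itv.
rewrite (@lebesgue_tuple_row_box (fun=> `[-r, r]%classic)); last first.
  by move=> i; exact: measurable_itv.
rewrite -ge0_fin_numE; last by apply: prode_ge0.
by apply: prode_fin_num => i _; rewrite lebesgue_measure_itv /=; case: ifP.
Qed.

(** A sup-norm ball inside [A] is a box with sides 2e, and its measure is a product of positive
    lengths. *)
Lemma volume_gt0 A B : open A -> A !=set0 -> vfin B -> A `<=` B -> 0 < volume B.
Proof.
move=> oA [x Ax] fB AB; rewrite -lte_fin volumeK //; case: (fB) => mB _.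
have /nbhs_ballP[e /= e0 eA] : nbhs x A by exact: open_nbhs_nbhs.
pose D i : set R := `](x ord0 i - e), (x ord0 i + e)[%classic.
have DB : row_preim [set y : 'rV[R]_n | forall i, D i (y ord0 i)] `<=`
    row_preim B.
  move=> t tD; apply/AB/eA/rV_ballP => // j.
  by rewrite ltr_norml; have := tD j; rewrite /D /= in_itv /=; lra.
have mD i : measurable (D i : set mR) by exact: measurable_itv.
have mDE : (lebesgue_tuple n
      (row_preim [set y : 'rV[R]_n | forall i, D i (y ord0 i)]) <=
    lebesgue_tuple n (row_preim B))%E.
  by apply: le_measure; rewrite ?inE //; exact: (vmeas_box mD).
apply: lt_le_trans mDE.
rewrite (@lebesgue_tuple_row_box D) //.
rewrite (eq_bigr (fun=> (e + e)%:E)).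
  by rewrite prodEFin lte_fin prodr_gt0 // => *; lra.
move=> i _; rewrite /D lebesgue_measure_itv /= lte_fin ifT; last lra.
by rewrite -EFinB; congr EFin; lra.
Qed.

Lemma volume_set0 : volume (@set0 'rV[R]_n) = 0.
Proof. by rewrite /volume (_ : [set _ | _] = set0) // measure0. Qed.

(** The origin is a box of singletons, and in positive dimension at least one factor of the product
    is 0. *)
Lemma volume_origin : (0 < n)%N -> volume [set (0 : 'rV[R]_n)] = 0.
Proof.
move=> n0; rewrite /volume.
have -> : [set t : n.-tuple mR | [set (0 : 'rV[R]_n)] (\row_i tnth t i)]
    = [set t | forall i, [set (0:R)] (tnth t i)].
  apply/seteqP; split => t /=.
    by move=> /rowP H i; have := H i; rewrite !mxE.
  by move=> H; apply/rowP => i; rewrite !mxE.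
rewrite (@lebesgue_tuple_box R n (fun=> [set 0])) // (bigD1 (Ordinal n0)) //=.
by rewrite lebesgue_measure_set1 mul0e.
Qed.

End volume_measure.

(** * Star bodies *)

Section star_bodies.
Context {R : realType} (n : nat).
Implicit Types (K L M C : set 'rV[R]_n) (x u : 'rV[R]_n).

Lemma enorm_ge0 x : 0 <= enorm x.
Proof. exact: sqrtr_ge0. Qed.

Lemma enormZ (s : R) x : 0 <= s -> enorm (s *: x) = s * enorm x.
Proof.
move=> s0; rewrite /enorm (eq_bigr (fun i => s ^+ 2 * x ord0 i ^+ 2)).
  by rewrite -mulr_sumr sqrtrM ?sqr_ge0 // sqrtr_sqr ger0_norm.
by move=> i _; rewrite mxE exprMn.
Qed.

Lemma coord_le_enorm x i : `|x ord0 i| <= enorm x.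
Proof.
rewrite -sqrtr_sqr ler_sqrt; last by apply: sumr_ge0 => j _; exact: sqr_ge0.
rewrite (bigD1 i) //= lerDl; apply: sumr_ge0 => j _; exact: sqr_ge0.
Qed.

Lemma enorm_gt0 x : x != 0 -> 0 < enorm x.
Proof.
move=> x0; rewrite lt_def enorm_ge0 andbT; apply: contra x0 => /eqP x0.
apply/eqP/rowP => i; apply/eqP; rewrite mxE -normr_le0 -x0.
exact: coord_le_enorm.
Qed.

Lemma enorm0 : enorm (0 : 'rV[R]_n) = 0.
Proof. by rewrite -(scale0r 0) enormZ // mul0r. Qed.

Lemma continuous_enorm : continuous (@enorm R n).
Proof.
move=> x; apply: (@continuous_comp _ _ _ (fun x => \sum_i x ord0 i ^+ 2));
  last first.
  exact: sqrt_continuous.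
(* The sum is generalized to an arbitrary list of indices to allow induction. *)
pose f (s : seq 'I_n) (y : 'rV[R]_n) : R := \sum_(i <- s) y ord0 i ^+ 2.
suff cf (s : seq 'I_n) : continuous (f s) by exact: cf.
elim: s => [|i s IH].
  rewrite (_ : f [::] = cst 0); first exact: cst_continuous.
  by apply/funext => y; rewrite /f big_nil.
rewrite (_ : f (i :: s) = fun y => y ord0 i ^+ 2 + f s y).
  by move=> y; apply: cvgD (IH y); apply: cvgM; exact: coord_continuous.
by apply/funext => y; rewrite /f big_cons.
Qed.

Lemma compact_unit_sphere : compact (@unit_sphere R n).
Proof.
apply: bounded_closed_compact.
  exists 1; split => // b b1 x x1; change (mx_norm x <= b); rewrite mx_normrE.
  apply: bigmax_le => [|[i j] _ /=]; first by rewrite (le_trans _ (ltW b1)).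
  by rewrite (ord1 i) (le_trans (coord_le_enorm _ _)) // x1 ltW.
rewrite (_ : @unit_sphere R n = @enorm R n @^-1` [set 1]) //.
by apply: closed_comp => // x _; exact: continuous_enorm.
Qed.

Lemma unit_sphere_neq0 u : unit_sphere u -> u != 0.
Proof.
by move=> u1; apply/eqP => u0; move: u1; rewrite u0 /unit_sphere /= enorm0;
  move/esym/eqP; rewrite oner_eq0.
Qed.

Definition dir x : 'rV[R]_n := (enorm x)^-1 *: x.

Lemma dir_unit_sphere x : x != 0 -> unit_sphere (dir x).
Proof.
move=> /enorm_gt0 x0; rewrite /unit_sphere /= /dir enormZ ?invr_ge0 ?enorm_ge0 //.
by rewrite mulVf // gt_eqF.
Qed.

Lemma dirZ (s : R) x : 0 < s -> dir (s *: x) = dir x.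
Proof.
move=> s0; rewrite /dir (enormZ _ (ltW s0)) scalerA invfM mulrAC mulVf ?mul1r //.
by rewrite gt_eqF.
Qed.

Lemma dir_id u : unit_sphere u -> dir u = u.
Proof. by rewrite /unit_sphere /= /dir => ->; rewrite invr1 scale1r. Qed.

Lemma enorm_dir x : x != 0 -> x = enorm x *: dir x.
Proof.
by move=> /enorm_gt0 x0; rewrite /dir scalerA divff ?scale1r // gt_eqF.
Qed.

Lemma continuous_dir x : x != 0 -> {for x, continuous dir}.
Proof.
move=> x0.
have e0 : enorm x != 0 by rewrite gt_eqF // enorm_gt0.
have FF : Filter (nbhs x) by exact: nbhs_filter.
have cV := @cvgV R _ (nbhs x) FF (@enorm R n) _ e0 (@continuous_enorm x).
exact: (@cvgZ R 'rV[R]_n 'rV[R]_n (nbhs x) FF _ id _ _ cV (@cvg_id _ _)).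
Qed.

(** Extends the radial function to be constant along open rays, so that continuity can be stated at
    nonzero points of the ambient space instead of relative to the sphere. *)
Definition rad K x := radial K (dir x).

Lemma radE K u : unit_sphere u -> rad K u = radial K u.
Proof. by move=> u1; rewrite /rad dir_id. Qed.

Lemma radZ K (s : R) x : 0 < s -> rad K (s *: x) = rad K x.
Proof. by move=> s0; rewrite /rad dirZ. Qed.

Lemma near_neq0 x : x != 0 -> \forall y \near x, y != 0.
Proof.
move=> x0.
suff : nbhs x (~` [set (0 : 'rV[R]_n)]).
  by apply: filterS => y /eqP.
apply: open_nbhs_nbhs; split; last exact/eqP.
exact/closed_openC/accessible_closed_set1/hausdorff_accessible/norm_hausdorff.
Qed.

(** Near a nonzero point [dir] is continuous and takes values in the sphere, so continuity relative
    to the sphere is enough. *)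
Lemma continuous_comp_dir (f : 'rV[R]_n -> R) x :
  {within @unit_sphere R n, continuous f} -> x != 0 ->
  {for x, continuous (fun x => f (dir x))}.
Proof.
move=> /subspace_continuousP cf x0.
have := cf _ (dir_unit_sphere x0); apply: cvg_trans => A /=.
rewrite !nbhs_simpl /= => /(continuous_dir x0); rewrite !nbhs_simpl /= => xA.
near=> y; have y0 : y != 0 by near: y; exact: near_neq0.
have : unit_sphere (dir y) -> A (f (dir y)) by near: y.
by apply; exact: dir_unit_sphere.
Unshelve. all: by end_near. Qed.

Lemma continuous_rad K x : star_body K -> x != 0 -> {for x, continuous (rad K)}.
Proof. by case=> _ _ cK _; exact: continuous_comp_dir. Qed.

Lemma rad_gt0 K x : star_body K -> x != 0 -> 0 < rad K x.
Proof. by case=> _ _ _ K0 x0; apply/K0/dir_unit_sphere. Qed.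

(** One direction is maximality of the radial function; conversely, x lies on the segment from 0 to
    the boundary point in its direction. *)
Lemma star_bodyP K x : star_body K -> x != 0 -> K x <-> enorm x <= rad K x.
Proof.
move=> sK x0; have := rad_gt0 sK x0; case: sK => Kseg Kmax _ _ r0.
have [Kr Kub] := Kmax _ (dir_unit_sphere x0); split => [Kx|xr].
  by apply: Kub; rewrite /ray /= -enorm_dir.
rewrite (_ : x = (enorm x / rad K x) *: (rad K x *: dir x)).
  apply: Kseg => //; apply/andP; split; last by rewrite ler_pdivrMr ?mul1r.
  by apply: divr_ge0; [exact: enorm_ge0|exact: ltW].
by rewrite scalerA divfK ?gt_eqF // -enorm_dir.
Qed.

(** Source of the openness, hence measurability, of the cones and punctured bodies below. *)
Lemma open_punctured (h : 'rV[R]_n -> R) :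
  (forall x, x != 0 -> {for x, continuous h}) ->
  open [set x | x != 0 /\ 0 < h x].
Proof.
move=> ch; rewrite openE => x [x0 hx]; near=> y; split.
  by near: y; exact: near_neq0.
near: y; exact: (cvgr_gt _ (ch _ x0)).
Unshelve. all: by end_near. Qed.

Hypothesis n_gt0 : (0 < n)%N.

Lemma unit_sphere_nonempty : (@unit_sphere R n) !=set0.
Proof.
exists (dir (const_mx 1)); apply: dir_unit_sphere.
apply/eqP => /rowP /(_ (Ordinal n_gt0)); rewrite !mxE => /eqP.
by rewrite oner_eq0.
Qed.

Lemma star_body0 K : star_body K -> K 0.
Proof.
case=> Kseg Kmax _ _; have [u /Kmax[Ku _]] := unit_sphere_nonempty.
by rewrite -(scale0r (radial K u *: u)); apply: Kseg; rewrite // lexx ler01.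
Qed.

Lemma rad_bounded K : star_body K -> exists b, forall x, x != 0 -> rad K x <= b.
Proof.
case=> _ _ cK _.
have [c _ cmax] := EVT_max_rV unit_sphere_nonempty compact_unit_sphere cK.
exists (radial K c) => x /dir_unit_sphere x1.
by apply: cmax; rewrite inE.
Qed.

(** A star body is bounded because its radial function has a maximum on the compact sphere, and
    closed because its complement is the open set of nonzero x with [rad K x < enorm x]. *)
Lemma star_body_vfin K : star_body K -> vfin K.
Proof.
move=> sK; have [b Kb] := rad_bounded sK.
have b0 : 0 <= b.
  have [u /unit_sphere_neq0 u0] := unit_sphere_nonempty.
  by rewrite (le_trans _ (Kb _ u0)) // ltW // rad_gt0.
apply: (@vfin_bounded _ _ b) => [|x Kx i].
  apply: closed_vmeas; rewrite -[K]setCK; apply: open_closedC.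
  rewrite (_ : ~` K = [set x | x != 0 /\ 0 < enorm x - rad K x]).
    apply: open_punctured => x x0.
    exact: continuousB (@continuous_enorm x) (continuous_rad sK x0).
  apply/seteqP; split => x /=.
    have [->|x0] := eqVneq x 0; first by move/(_ (star_body0 sK)).
    by rewrite star_bodyP // subr_gt0 ltNge => /negP.
  by move=> [x0]; rewrite star_bodyP // subr_gt0 ltNge => /negP.
have [x0|x0] := eqVneq x 0; first by rewrite x0 mxE normr0.
rewrite (le_trans (coord_le_enorm _ _)) // (le_trans _ (Kb _ x0)) //.
exact/star_bodyP.
Qed.

(** The origin is added by hand: [dir 0] is 0, which is off the sphere, where nothing is known about
    [r]. *)
Definition star_of (r : 'rV[R]_n -> R) : set 'rV[R]_n :=
  [set x | x = 0 \/ enorm x <= r (dir x)].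

Lemma ray_star_of (r : 'rV[R]_n -> R) u : unit_sphere u -> 0 < r u ->
  ray (star_of r) u (r u) /\ ubound (ray (star_of r) u) (r u).
Proof.
move=> u1 ru0; have u0 := unit_sphere_neq0 u1.
have key l : 0 < l -> star_of r (l *: u) <-> l <= r u.
  move=> l0; rewrite /star_of /= (enormZ _ (ltW l0)) u1 mulr1 dirZ // dir_id //.
  split => [[/eqP|//]|]; last by right.
  by rewrite scaler_eq0 gt_eqF //= (negbTE u0).
split; first exact/key.
by move=> l /= lu; have [l0|l0] := ltP 0 l; [exact/key|exact: le_trans l0 (ltW _)].
Qed.

Lemma radial_star_of (r : 'rV[R]_n -> R) u : unit_sphere u -> 0 < r u ->
  radial (star_of r) u = r u.
Proof.
move=> u1 ru0; have [ru rub] := ray_star_of u1 ru0.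
apply/eqP; rewrite eq_le; apply/andP; split.
  by apply: ge_sup => //; exists (r u).
by apply: ub_le_sup => //; exists (r u).
Qed.

Lemma star_body_star_of (r : 'rV[R]_n -> R) :
  (forall u, unit_sphere u -> 0 < r u) -> {within @unit_sphere R n, continuous r} ->
  star_body (star_of r).
Proof.
move=> r0 cr; split.
- move=> x Kx t /andP[t0 t1].
  have [x0|x0] := eqVneq x 0; first by left; rewrite x0 scaler0.
  move: t0; rewrite le_eqVlt => /predU1P[<-|t0]; first by left; rewrite scale0r.
  case: Kx => [/eqP|Kx]; first by rewrite (negbTE x0).
  right; rewrite dirZ // (enormZ _ (ltW t0)); apply: le_trans Kx.
  by rewrite ger_pMl // enorm_gt0.
- move=> u u1; rewrite radial_star_of ?r0 //; exact: ray_star_of (r0 _ u1).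
- have rE : {in @unit_sphere R n, r =1 radial (star_of r)}.
    by move=> u; rewrite inE => u1; rewrite radial_star_of ?r0.
  exact: (subspace_eq_continuous rE cr).
- by move=> u u1; rewrite radial_star_of ?r0.
Qed.

End star_bodies.

(** * Volumes in cones *)

Section cones.
Context {R : realType} (n : nat) (n_gt0 : (0 < n)%N).
Implicit Types (K L M C X : set 'rV[R]_n) (x u : 'rV[R]_n).

(** Cones omit the origin, where [dir] gives no direction; this costs nothing because the origin is
    a null set. *)
Definition cone C := ~ C 0 /\ forall (s : R) x, 0 < s -> C x -> C (s *: x).

Lemma cone_neq0 C x : cone C -> C x -> x != 0.
Proof. by move=> [C0 _] Cx; apply/eqP => x0; apply: C0; rewrite -x0. Qed.

(** In polar coordinates this is the density of |K & C| with respect to |M & C| as functions of the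
    cone C. *)
Definition ratio K M x := (rad K x / rad M x) ^+ n.

Lemma ratio_gt0 K M x : star_body K -> star_body M -> x != 0 -> 0 < ratio K M x.
Proof. by move=> sK sM x0; rewrite exprn_gt0 // divr_gt0 // rad_gt0. Qed.

Lemma ratioZ K M (s : R) x : 0 < s -> ratio K M (s *: x) = ratio K M x.
Proof. by move=> s0; rewrite /ratio !radZ. Qed.

Lemma continuous_ratio K M x : star_body K -> star_body M -> x != 0 ->
  {for x, continuous (ratio K M)}.
Proof.
move=> sK sM x0.
apply: (@continuous_comp _ _ _ (fun x => rad K x / rad M x) (fun y => y ^+ n)).
  apply: continuousM; first exact: continuous_rad.
  by apply: continuousV; [rewrite gt_eqF // rad_gt0|exact: continuous_rad].
exact: exprn_continuous.
Qed.

Lemma rad_bounded_below K : star_body K ->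
  exists2 c, 0 < c & forall x, x != 0 -> c <= rad K x.
Proof.
case=> _ _ cK K0.
have [c] := EVT_min_rV (unit_sphere_nonempty (R := R) n_gt0)
  (@compact_unit_sphere R n) cK.
rewrite inE => c1 cmin; exists (radial K c); first exact: K0.
by move=> x /dir_unit_sphere x1; apply: cmin; rewrite inE.
Qed.

Lemma ratio_bounded K M : star_body K -> star_body M ->
  exists b, forall x, x != 0 -> ratio K M x <= b.
Proof.
move=> sK sM; have [b Kb] := rad_bounded n_gt0 sK.
have [c c0 Mc] := rad_bounded_below sM.
exists ((b / c) ^+ n) => x x0; have Kx := rad_gt0 sK x0.
rewrite lerXn2r // ?nnegrE ?divr_ge0 //
  ?(ltW c0) ?(ltW (rad_gt0 sM x0)) ?(ltW Kx) //.
  exact: le_trans (ltW Kx) (Kb _ x0).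
by apply: ler_pM; rewrite ?invr_ge0 ?(ltW Kx) ?(ltW (rad_gt0 sM x0)) ?Kb //
  lef_pV2 ?posrE ?rad_gt0 // Mc.
Qed.

(** With s = b^(1/n), dilation by 1/s carries K & C into M & C, and it divides volumes by b. *)
Lemma cone_volume_le K M C (b : R) : star_body K -> star_body M ->
  vmeas C -> cone C -> 0 < b -> (forall x, C x -> ratio K M x <= b) ->
  volume (K `&` C) <= b * volume (M `&` C).
Proof.
move=> sK sM mC cC b0 Cb.
have [mK _] := star_body_vfin n_gt0 sK; have fM := star_body_vfin n_gt0 sM.
pose s := b `^ n%:R^-1.
have s0 : 0 < s by exact: powR_gt0.
have sb : s ^+ n = b.
  by rewrite -powR_mulrn ?ltW // -powRrM mulVf ?powRr1 ?ltW // pnatr_eq0 -lt0n.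
have mKC := vmeasI mK mC.
rewrite -(volume_scale s0 mKC) sb ler_pM2l //.
apply: le_volume; [exact: vmeas_scale|exact: vfinI|move=> x [Kx Cx]].
have {}Cx : C x.
  rewrite -(scale1r x) -(mulVf (lt0r_neq0 s0)) -scalerA.
  by apply cC.2; rewrite ?invr_gt0.
have x0 := cone_neq0 cC Cx; split=> //; apply/star_bodyP => //.
have sx0 : s *: x != 0 by rewrite scaler_eq0 negb_or x0 gt_eqF.
move: Kx => /(star_bodyP sK sx0); rewrite radZ // (enormZ _ (ltW s0)) => sxK.
have : rad K x / rad M x <= s.
  have r0 : 0 <= rad K x / rad M x.
    by apply: divr_ge0; apply: ltW; exact: rad_gt0.
  by have := Cb _ Cx; rewrite /ratio -sb ler_pXn2r // nnegrE ltW.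
rewrite ler_pdivrMr ?rad_gt0 // => KM.
by rewrite -(ler_pM2l s0) (le_trans sxK).
Qed.

(** The lower bound is the upper bound with the two bodies exchanged, since [ratio M K] is the
    reciprocal of [ratio K M]. The value a = 0 is allowed because the first grid cell starts
    there. *)
Lemma cone_volume_cell K M C (a b : R) : star_body K -> star_body M ->
  vmeas C -> cone C -> 0 <= a -> 0 < b ->
  (forall x, C x -> a <= ratio K M x <= b) ->
  a * volume (M `&` C) <= volume (K `&` C) <= b * volume (M `&` C).
Proof.
move=> sK sM mC cC a0 b0 Cab; apply/andP; split; last first.
  by apply: cone_volume_le => // x /Cab /andP[].
move: a0; rewrite le_eqVlt => /predU1P[<-|a0]; first by rewrite mul0r volume_ge0.
rewrite -ler_pdivlMl //; apply: cone_volume_le => //; first by rewrite invr_gt0.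
move=> x Cx; have x0 := cone_neq0 cC Cx; have /andP[ax _] := Cab _ Cx.
rewrite (_ : ratio M K x = (ratio K M x)^-1).
  by rewrite lef_pV2 // posrE ratio_gt0.
by rewrite /ratio -exprVn invf_div.
Qed.

(** Telescoping: each layer [E j.+1] minus [E j] contributes the increase from |A & E j| to |A & E
    (j+1)|. *)
Lemma volume_partition (E : nat -> set 'rV[R]_n) A m : vfin A ->
  (forall j, vmeas (E j)) -> (forall j, E j `<=` E j.+1) ->
  A `&` E 0%N = set0 ->
  volume (A `&` E m) = \sum_(j < m) volume (A `&` (E j.+1 `\` E j)).
Proof.
move=> fA mE sE A0; elim: m => [|m IH].
  by rewrite big_ord0 A0 volume_set0.
rewrite big_ord_recr /= -IH (volumeDI (vfinI fA (mE m.+1)) (mE m)) addrC.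
have -> : A `&` E m.+1 `&` E m = A `&` E m.
  by rewrite -setIA; congr (_ `&` _); apply/setIidPr; exact: sE.
by rewrite setIDA.
Qed.

Definition below (f : 'rV[R]_n -> R) (t : R) := [set x | x != 0 /\ f x < t].

Lemma vmeas_below_ratio K M t : star_body K -> star_body M ->
  vmeas (below (ratio K M) t).
Proof.
move=> sK sM; rewrite (_ : below _ _ = [set x | x != 0 /\ 0 < t - ratio K M x]).
  apply: open_vmeas; apply: open_punctured => x x0; apply: continuousB.
    exact: cst_continuous.
  exact: continuous_ratio.
by apply/seteqP; split => x /= [x0]; rewrite subr_gt0.
Qed.

Lemma cone_below_ratioD K M (s t : R) C : cone C ->
  cone (C `&` (below (ratio K M) t `\` below (ratio K M) s)).
Proof.
move=> [C0 CZ]; split => [[]//|l x l0 [Cx [[x0 xt] xs]]]; split; first exact: CZ.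
have lx0 : l *: x != 0 by rewrite scaler_eq0 negb_or x0 gt_eqF.
split; first by split => //; rewrite ratioZ.
by move=> [_]; rewrite ratioZ // => ?; apply: xs.
Qed.

(** Fix any x in the cell. For T = K, L, both |T & C| and [ratio T M x] |M & C| lie in an interval
    of length w |M & C|, so one may replace the other at that cost; then the linear inequality at x
    is used. The coefficients may have any sign, hence the absolute values. *)
Lemma grid_cell_le K L M C (al be ga w : R) (j k : nat) :
  star_body K -> star_body L -> star_body M -> 0 < w ->
  vmeas C -> cone C ->
  (forall x, C x -> al * ratio K M x + be * ratio L M x <= ga) ->
  (forall x, C x -> j%:R * w <= ratio K M x <= j.+1%:R * w) ->
  (forall x, C x -> k%:R * w <= ratio L M x <= k.+1%:R * w) ->
  al * volume (K `&` C) + be * volume (L `&` C) <=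
  (ga + (`|al| + `|be|) * w) * volume (M `&` C).
Proof.
move=> sK sL sM w0 mC cC Cl Cj Ck.
have [->|/set0P[x Cx]] := eqVneq C set0.
  by rewrite !setI0 !volume_set0 !mulr0 addr0.
have close T (i : nat) (c : R) : star_body T ->
    (forall x, C x -> i%:R * w <= ratio T M x <= i.+1%:R * w) ->
    c * volume (T `&` C) <= (c * ratio T M x + `|c| * w) * volume (M `&` C).
  move=> sT Ci.
  have i0 : 0 <= i%:R * w by rewrite mulr_ge0 ?ler0n ?ltW.
  have i1 : 0 < i.+1%:R * w by rewrite mulr_gt0 ?ltr0n.
  have /andP[lo hi] := cone_volume_cell sT sM mC cC i0 i1 Ci.
  have /andP[rlo rhi] := Ci _ Cx.
  have vM := volume_ge0 (M `&` C).
  rewrite mulrDl -lerBlDl -!mulrA -mulrBr.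
  apply: le_trans (ler_norm _) _; rewrite normrM; apply: ler_wpM2l => //.
  rewrite ler_norml; apply/andP; split; rewrite -subr_ge0.
    have : 0 <= (i.+1%:R * w - ratio T M x) * volume (M `&` C).
      by rewrite mulr_ge0 // subr_ge0.
    by move: lo; rewrite -natr1; lra.
  have : 0 <= (ratio T M x - i%:R * w) * volume (M `&` C).
    by rewrite mulr_ge0 // subr_ge0.
  by move: hi; rewrite -natr1; lra.
have := lerD (close K j al sK Cj) (close L k be sL Ck).
move=> /le_trans; apply; rewrite -mulrDl ler_wpM2r ?volume_ge0 //.
by have := Cl _ Cx; lra.
Qed.

Lemma grid_le K L M C (al be ga w : R) :
  star_body K -> star_body L -> star_body M -> 0 < w ->
  vmeas C -> cone C ->
  (forall x, C x -> al * ratio K M x + be * ratio L M x <= ga) ->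
  al * volume (K `&` C) + be * volume (L `&` C) <=
  (ga + (`|al| + `|be|) * w) * volume (M `&` C).
Proof.
move=> sK sL sM w0 mC cC Cl.
pose E T (j : nat) := below (ratio T M) (j%:R * w).
pose D T (j : nat) := E T j.+1 `\` E T j.
have sE T j : E T j `<=` E T j.+1.
  move=> x [x0 xj]; split => //; apply: lt_le_trans xj _.
  by rewrite ler_pM2r // ler_nat.
have mE T j : star_body T -> vmeas (E T j).
  by move=> sT; exact: vmeas_below_ratio.
have E0 T A : star_body T -> A `&` E T 0%N = set0.
  move=> sT; apply/seteqP; split => // x [_ [x0]].
  by rewrite mul0r ltNge (ltW (ratio_gt0 sT sM x0)).
have full T : star_body T -> exists m, C `<=` E T m.
  move=> sT; have [b Tb] := ratio_bounded sT sM.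
  (* The maximum with 0 makes the quotient nonnegative, as the Archimedean bound requires. *)
  exists (Num.bound (Num.max b 0 / w)) => x Cx; have x0 := cone_neq0 cC Cx.
  split => //; rewrite -ltr_pdivrMr //.
  apply: le_lt_trans (archi_boundP _); last first.
    by rewrite divr_ge0 ?(ltW w0) // le_max lexx orbT.
  by rewrite ler_pM2r ?invr_gt0 // le_max Tb.
have [mk fK] := full K sK; have [ml fL] := full L sL.
(* The cone is cut first into layers of [ratio K M], then each of these into layers of [ratio L M];
   both families exhaust it after finitely many steps. *)
have split2 T : star_body T -> volume (T `&` C) =
    \sum_(j < mk) \sum_(k < ml) volume (T `&` (C `&` D K j `&` D L k)).
  move=> sT; have fT := vfinI (star_body_vfin n_gt0 sT) mC.
  rewrite -[in LHS](setIidl fK) setIA (volume_partition mk fT) //; last first.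
  - exact: E0.
  - by move=> j; exact: mE.
  apply: eq_bigr => j _.
  have mD : vmeas (D K j) by apply: vmeasD; exact: mE.
  have sub : T `&` C `&` D K j `<=` E L ml by move=> x [[_ /fL]].
  rewrite -[in LHS](setIidl sub) (volume_partition ml (vfinI fT mD)) //; last first.
  - exact: E0.
  - by move=> k; exact: mE.
  by apply: eq_bigr => k _; rewrite !setIA.
rewrite !split2 // !mulr_sumr -big_split /=; apply: ler_sum => j _.
rewrite !mulr_sumr -big_split /=; apply: ler_sum => k _.
have mD T i : star_body T -> vmeas (D T i).
  by move=> sT; apply: vmeasD; exact: mE.
have DP T i x : x != 0 -> D T i x -> i%:R * w <= ratio T M x <= i.+1%:R * w.
  move=> x0 [[_ /ltW ->] xi]; rewrite andbT leNgt; apply/negP => xi'.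
  by apply: xi; split.
apply: (grid_cell_le (j := j) (k := k)) => //.
- by apply: vmeasI; [apply: vmeasI|]; try exact: mD.
- by apply: cone_below_ratioD; exact: cone_below_ratioD.
- by move=> x [[/Cl]].
- by move=> x [[/(cone_neq0 cC) x0 /(DP _ _ _ x0)]].
- by move=> x [[/(cone_neq0 cC) x0 _] /(DP _ _ _ x0)].
Qed.

(** The limit of [grid_le] as the mesh w tends to 0. For a prescribed error e, the mesh is e divided
    by (|al| + |be|) |M & C| + 1, where the summand 1 keeps the divisor positive. *)
Lemma cone_volume_linear_le K L M C (al be ga : R) :
  star_body K -> star_body L -> star_body M -> vmeas C -> cone C ->
  (forall x, C x -> al * ratio K M x + be * ratio L M x <= ga) ->
  al * volume (K `&` C) + be * volume (L `&` C) <= ga * volume (M `&` C).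
Proof.
move=> sK sL sM mC cC Cl; apply/ler_addgt0Pr => e e0.
have d0 : 0 < (`|al| + `|be|) * volume (M `&` C) + 1.
  by rewrite ltr_wpDl // mulr_ge0 ?addr_ge0 ?volume_ge0.
have w0 := divr_gt0 e0 d0.
apply: le_trans (grid_le sK sL sM w0 mC cC Cl) _.
rewrite mulrDl lerD2l mulrAC mulrA ler_pdivrMr // mulrC ler_pM2l //.
by rewrite lerDl.
Qed.

End cones.

(** * Jensen's inequality for volumes *)

Section supporting_plane.
Context {R : realType}.

(* The one-dimensional extension step of the Hahn-Banach theorem. *)
Lemma separating_slope (T : Type) (D : set T) (G l : T -> R) :
  (exists2 x, D x & l x < 0) -> (exists2 y, D y & 0 < l y) ->
  (forall x, D x -> l x = 0 -> 0 <= G x) ->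
  (forall x y, D x -> D y -> l x < 0 -> 0 < l y ->
    0 <= l y * G x - l x * G y) ->
  exists b, forall x, D x -> b * l x <= G x.
Proof.
move=> [x0 Dx0 lx0] [y0 Dy0 ly0] G0 Gxy.
pose S := [set G x / l x | x in [set x | D x /\ l x < 0]].
have Sub y : D y -> 0 < l y -> ubound S (G y / l y).
  move=> Dy ly _ [x [Dx lx] <-].
  rewrite ler_ndivrMr // mulrAC ler_pdivrMr //.
  by have := Gxy _ _ Dx Dy lx ly; lra.
have S0 : S !=set0 by exists (G x0 / l x0); exists x0.
exists (sup S) => x Dx; have [lx|lx|lx] := ltgtP (l x) 0.
- rewrite -ler_ndivrMr //; apply: ub_le_sup; last by exists x.
  by exists (G y0 / l y0); exact: Sub.
- by rewrite -ler_pdivlMr //; apply: ge_sup => //; exact: Sub.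
- by rewrite lx mulr0; exact: G0.
Qed.

Definition convex2 (g : R -> R -> R) := forall t a b c d : R, 0 < t < 1 ->
  0 < a -> 0 < b -> 0 < c -> 0 < d ->
  g (t * a + (1 - t) * c) (t * b + (1 - t) * d) <= t * g a b + (1 - t) * g c d.

Definition strictly_convex2 (g : R -> R -> R) :=
  forall t a b c d : R, 0 < t < 1 ->
  0 < a -> 0 < b -> 0 < c -> 0 < d -> (a, b) != (c, d) ->
  g (t * a + (1 - t) * c) (t * b + (1 - t) * d) < t * g a b + (1 - t) * g c d.

(** Two extension steps: the slope [al] is found on the line through (p, q) parallel to the first
    axis, and [be] then extends the minorant to the quadrant. *)
Lemma convex2_supporting_plane (g : R -> R -> R) (p q : R) :
  convex2 g -> 0 < p -> 0 < q ->
  exists al be, forall a b, 0 < a -> 0 < b ->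
    g p q + al * (a - p) + be * (b - q) <= g a b.
Proof.
move=> cg p0 q0.
(* The barycentric weight of z between x and y; the relation [t * (y - x) = y - z] serves later to
   clear denominators. *)
have weight (x y z : R) : x < z -> z < y -> exists t, [/\ 0 < t < 1,
    t * (y - x) = y - z & t * x + (1 - t) * y = z].
  move=> xz zy; exists ((y - z) / (y - x)).
  have d0 : 0 < y - x by lra.
  have tE : (y - z) / (y - x) * (y - x) = y - z by rewrite divfK // gt_eqF.
  split => //; last by move: tE; set t := _ / _; lra.
  apply/andP; split; first by rewrite divr_gt0 // subr_gt0.
  by rewrite ltr_pdivrMr // mul1r; lra.
have [al alP] : exists al, forall a, 0 < a -> al * (a - p) <= g a q - g p q.
  apply: (@separating_slope R [set a | 0 < a] (fun a => g a q - g p q)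
    (fun a => a - p)) => /=.
  - by exists (p / 2) => /=; lra.
  - by exists (p + 1) => /=; lra.
  - by move=> a _ /eqP; rewrite subr_eq0 => /eqP ->; rewrite subrr.
  - move=> a c a0 c0 ap cp.
    have [t [t01 tE tp]] := weight a c p ltac:(lra) ltac:(lra).
    have := cg t a q c q t01 a0 q0 c0 q0.
    rewrite tp -mulrDl addrC subrK mul1r => H.
    have d0 : 0 <= c - a by lra.
    have := mulr_ge0 d0 (_ : 0 <= t * g a q + (1 - t) * g c q - g p q).
    rewrite subr_ge0 => /(_ H).
    have -> : c - p = t * (c - a) by [].
    have -> : a - p = t * (c - a) - (c - a) by rewrite tE; lra.
    lra.
have [be beP] : exists be, forall x : R * R, (0 < x.1) && (0 < x.2) ->
    be * (x.2 - q) <= g x.1 x.2 - g p q - al * (x.1 - p).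
  apply: (@separating_slope _ [set x : R * R | (0 < x.1) && (0 < x.2)]
    (fun x => g x.1 x.2 - g p q - al * (x.1 - p)) (fun x => x.2 - q)) => /=.
  - by exists (p, q / 2) => /=; [apply/andP; split|]; lra.
  - by exists (p, q + 1) => /=; [apply/andP; split|]; lra.
  - move=> [a b] /= /andP[a0 b0] /eqP; rewrite subr_eq0 => /eqP ->.
    by have := alP a a0; lra.
  - move=> [a b] [c d] /= /andP[a0 b0] /andP[c0 d0] bq dq.
    have [t [t01 tE tq]] := weight b d q ltac:(lra) ltac:(lra).
    have := cg t a b c d t01 a0 b0 c0 d0; rewrite tq.
    (* This is the first coordinate of the point where the segment from (a, b) to (c, d) meets the
       line of second coordinate q; the slope [al] already supports g there. *)
    have z0 : 0 < t * a + (1 - t) * c.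
      by rewrite addr_gt0 // mulr_gt0 //; lra.
    move: (alP _ z0) => H1 H2.
    have e0 : 0 <= d - b by lra.
    have := mulr_ge0 e0 (_ : 0 <= t * (g a b - g p q - al * (a - p)) +
       (1 - t) * (g c d - g p q - al * (c - p))).
    have H : 0 <= t * (g a b - g p q - al * (a - p)) +
       (1 - t) * (g c d - g p q - al * (c - p)) by lra.
    move=> /(_ H).
    have -> : d - q = t * (d - b) by [].
    have -> : b - q = t * (d - b) - (d - b) by rewrite tE; lra.
    lra.
exists al, be => a b a0 b0.
by have := beP (a, b) (introT andP (conj a0 b0)); rewrite /=; lra.
Qed.

(** At the midpoint of (a, b) and (p, q) the plane is still below g, while strict convexity puts g
    there strictly below the mean of its end values. *)
Lemma strictly_convex2_supporting_plane (g : R -> R -> R) (p q al be : R) :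
  strictly_convex2 g -> 0 < p -> 0 < q ->
  (forall a b, 0 < a -> 0 < b ->
    g p q + al * (a - p) + be * (b - q) <= g a b) ->
  forall a b, 0 < a -> 0 < b -> (a, b) != (p, q) ->
    g p q + al * (a - p) + be * (b - q) < g a b.
Proof.
move=> sg p0 q0 H a b a0 b0 ab.
have h : 0 < (2^-1 : R) < 1 by lra.
have := sg _ _ _ _ _ h a0 b0 p0 q0 ab.
have := H (2^-1 * a + (1 - 2^-1) * p) (2^-1 * b + (1 - 2^-1) * q).
by move=> /(_ ltac:(lra) ltac:(lra)); lra.
Qed.

End supporting_plane.

(** * Jensen's inequality on a level set of g, and its equality case *)

Section jensen.
Context {R : realType} (n : nat) (n_gt0 : (0 < n)%N).
Variables K L M : set 'rV[R]_n.
Hypotheses (sK : star_body K) (sL : star_body L) (sM : star_body M).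
Variables (g : R -> R -> R) (c : R).
Hypothesis gc : forall x : 'rV[R]_n,
  x != 0 -> g (ratio K M x) (ratio L M x) = c.

Let X : set 'rV[R]_n := [set x | x != 0].

Let oX : open X.
Proof. by rewrite openE => x; exact: near_neq0. Qed.

Let coneX : cone X.
Proof.
split => [/eqP//|s x s0 x0].
by rewrite /X /= scaler_eq0 negb_or x0 gt_eqF.
Qed.

Lemma volume_punctured (T : set 'rV[R]_n) :
  star_body T -> volume (T `&` X) = volume T.
Proof.
move=> sT; have fT := star_body_vfin n_gt0 sT.
rewrite [RHS](volumeDI fT (open_vmeas oX)).
suff -> : T `\` X = [set 0] by rewrite volume_origin // add0r.
apply/seteqP; split => x /=; last first.
  by move=> ->; split; [exact: star_body0|by move=> /eqP].
by move=> [_ /negP]; rewrite negbK => /eqP.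
Qed.

Lemma star_body_volume_gt0 (T : set 'rV[R]_n) : star_body T -> 0 < volume T.
Proof.
move=> sT; apply: (@volume_gt0 _ _ [set x | x != 0 /\ 0 < rad T x - enorm x]).
- apply: open_punctured => x x0; apply: continuousB; first exact: continuous_rad.
  exact: continuous_enorm.
- have [u u1] := unit_sphere_nonempty (R := R) n_gt0.
  have u0 := unit_sphere_neq0 u1; have r0 := rad_gt0 sT u0.
  have h0 : 0 < rad T u / 2 by lra.
  exists ((rad T u / 2) *: u); split; first by rewrite scaler_eq0 negb_or u0 gt_eqF.
  by rewrite radZ // (enormZ _ (ltW h0)) u1; lra.
- exact: star_body_vfin.
- by move=> x [x0]; rewrite subr_gt0 => /ltW ?; apply/star_bodyP.
Qed.

Let p := volume K / volume M.
Let q := volume L / volume M.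
Let p_gt0 : 0 < p. Proof. by rewrite divr_gt0 // star_body_volume_gt0. Qed.
Let q_gt0 : 0 < q. Proof. by rewrite divr_gt0 // star_body_volume_gt0. Qed.

(** In the volume form of the supporting-plane inequality at (p, q), the linear terms cancel because
    p |M| = |K| and q |M| = |L|. *)
Lemma jensen_volume : convex2 g -> g p q <= c.
Proof.
move=> cg; have [al [be H]] := convex2_supporting_plane cg p_gt0 q_gt0.
have vM := star_body_volume_gt0 sM.
have Xl x : X x -> al * ratio K M x + be * ratio L M x <=
    c - g p q + al * p + be * q.
  move=> x0; have := H _ _ (ratio_gt0 sK sM x0) (ratio_gt0 sL sM x0).
  by rewrite gc //; lra.
have := cone_volume_linear_le n_gt0 sK sL sM (open_vmeas oX) coneX Xl.
rewrite !volume_punctured //.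
have -> : volume K = p * volume M by rewrite divfK // gt_eqF.
have -> : volume L = q * volume M by rewrite divfK // gt_eqF.
by rewrite !mulrA -mulrDl ler_pM2r //; lra.
Qed.

Lemma jensen_volume_eq : convex2 g -> strictly_convex2 g -> g p q = c ->
  forall x : 'rV[R]_n, x != 0 -> ratio K M x = p /\ ratio L M x = q.
Proof.
move=> cg sg gpq y y0.
have [al [be H]] := convex2_supporting_plane cg p_gt0 q_gt0.
have [/eqP[]//|yn] := boolP ((ratio K M y, ratio L M y) == (p, q)).
have Hs := strictly_convex2_supporting_plane sg p_gt0 q_gt0 H.
(* The gap in the supporting-plane inequality along the level set: nonnegative everywhere, and
   positive at y by strict convexity. *)
pose h (x : 'rV[R]_n) := al * p + be * q - (al * ratio K M x + be * ratio L M x).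
have vM := star_body_volume_gt0 sM.
have h0 x : x != 0 -> 0 <= h x.
  move=> x0; have := H _ _ (ratio_gt0 sK sM x0) (ratio_gt0 sL sM x0).
  by rewrite gc // gpq /h; lra.
have hy : 0 < h y.
  have := Hs _ _ (ratio_gt0 sK sM y0) (ratio_gt0 sL sM y0) yn.
  by rewrite gc // gpq /h; lra.
have hZ (s : R) (x : 'rV[R]_n) : 0 < s -> h (s *: x) = h x.
  by move=> s0; rewrite /h !ratioZ.
have ch x : x != 0 -> {for x, continuous h}.
  move=> x0; apply: continuousB; first exact: cst_continuous.
  apply: continuousD; apply: continuousM; try exact: cst_continuous;
    exact: continuous_ratio.
(* Half of the gap at y, so that the open cone where the gap exceeds d contains y. *)
pose d := h y / 2; have d0 : 0 < d by rewrite /d; lra.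
pose C := [set x : 'rV[R]_n | x != 0 /\ 0 < h x - d].
have oC : open C.
  apply: open_punctured => x x0; apply: continuousB; first exact: ch.
  exact: cst_continuous.
have neqZ (s : R) (x : 'rV[R]_n) : 0 < s -> x != 0 -> s *: x != 0.
  by move=> s0 x0; rewrite scaler_eq0 negb_or x0 gt_eqF.
have cC : cone C.
  split => [[/eqP]//|s x s0 [x0 hx]]; split; first exact: neqZ.
  by rewrite hZ.
have cXC : cone (X `\` C).
  split => [[/eqP]//|s x s0 [x0 Cx]]; split; first exact: neqZ.
  by move=> [_]; rewrite hZ // => ?; apply: Cx.
have lC x : C x -> al * ratio K M x + be * ratio L M x <= al * p + be * q - d.
  by move=> [_]; rewrite /h; lra.
have lXC x : (X `\` C) x -> al * ratio K M x + be * ratio L M x <= al * p + be * q.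
  by move=> [/h0]; rewrite /h; lra.
have mX := open_vmeas oX; have mC := open_vmeas oC.
have := cone_volume_linear_le n_gt0 sK sL sM mC cC lC.
have := cone_volume_linear_le n_gt0 sK sL sM (vmeasD mX mC) cXC lXC.
have CX : C `<=` X by move=> x [].
have split1 (T : set 'rV[R]_n) : star_body T ->
    volume T = volume (T `&` (X `\` C)) + volume (T `&` C).
  move=> sT; have fT := vfinI (star_body_vfin n_gt0 sT) mX.
  rewrite -[LHS]volume_punctured // (volumeDI fT mC) setIDA; congr (_ + volume _).
  by rewrite -setIA (setIidr CX).
have vMC : 0 < volume (M `&` C).
  (* The minimum is positive exactly where both terms are, which gives an open part of M & C; it
     contains the multiple of y with half the norm of the boundary point of M on its ray. *)
  pose f (x : 'rV[R]_n) := Num.min (rad M x - enorm x) (h x - d).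
  apply: (@volume_gt0 _ _ [set x | x != 0 /\ 0 < f x]).
  - apply: open_punctured => x x0; apply: continuous_min.
      apply: continuousB; [exact: continuous_rad|exact: continuous_enorm].
    by apply: continuousB; [exact: ch|exact: cst_continuous].
  - have r0 := rad_gt0 sM y0; have e0 := enorm_gt0 y0.
    have s0 : 0 < rad M y / enorm y / 2 by rewrite !divr_gt0.
    exists ((rad M y / enorm y / 2) *: y); split; first exact: neqZ.
    rewrite lt_min radZ // (enormZ _ (ltW s0)) hZ //.
    rewrite mulrAC divfK ?gt_eqF //; apply/andP; split; first by lra.
    by rewrite /d; lra.
  - apply: vfinI => //; exact: star_body_vfin.
  - move=> x [x0]; rewrite lt_min => /andP[rx hx]; split => //.
    by apply/star_bodyP => //; lra.
(* Added up, the two estimates give al |K| + be |L| <= (al p + be q) |M| - d |M & C|, whereas the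
   left side equals (al p + be q) |M|. *)
move=> H1 H2.
have KE : volume K = p * volume M by rewrite divfK // gt_eqF.
have LE : volume L = q * volume M by rewrite divfK // gt_eqF.
have : 0 < d * volume (M `&` C) by exact: mulr_gt0.
move: KE LE H1 H2; rewrite (split1 K) // (split1 L) // (split1 M) // => KE LE.
have := congr2 (fun u v => al * u + be * v) KE LE => /=.
lra.
Qed.

(** The linear inequality with coefficients 1 and -1 gives the two bounds; the second body enters
    with coefficient 0. *)
Lemma volume_const_ratio (a : R) :
  (forall x : 'rV[R]_n, x != 0 -> ratio K M x = a) -> volume K / volume M = a.
Proof.
move=> Ka; have vM := star_body_volume_gt0 sM; have mX := open_vmeas oX.
have le1 x : X x -> 1 * ratio K M x + 0 * ratio K M x <= a.
  by move=> /Ka ->; lra.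
have le2 x : X x -> (-1) * ratio K M x + 0 * ratio K M x <= - a.
  by move=> /Ka ->; lra.
have := cone_volume_linear_le n_gt0 sK sK sM mX coneX le1.
have := cone_volume_linear_le n_gt0 sK sK sM mX coneX le2.
rewrite !volume_punctured // => H1 H2.
apply/eqP; rewrite eq_le ler_pdivrMr // ler_pdivlMr //; lra.
Qed.

End jensen.

(** * Orlicz radial sums *)

Section orlicz_gauge.
Context {R : realType}.
Implicit Types (phi psi : 'rV[R]_2 -> R).

(** Together with [monotone_gauge], this is what the later proofs use of the two classes, so both
    are treated at once. *)
Definition solvable_gauge phi := forall a b : R, 0 < a -> 0 < b ->
  exists2 l, 0 < l & phi (vec2 (l / a) (l / b)) = 1.

(* Also yields uniqueness of the solution, by taking equal radii. *)
Definition monotone_gauge phi := forall a b a' b' l l' : R,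
  0 < a -> 0 < b -> 0 < l -> 0 < l' -> a <= a' -> b <= b' ->
  phi (vec2 (l / a) (l / b)) = 1 -> phi (vec2 (l' / a') (l' / b')) = 1 ->
  l <= l'.

Lemma vec2_0 (a b : R) : vec2 a b ord0 0 = a.
Proof. by rewrite mxE. Qed.

Lemma vec2_1 (a b : R) : vec2 a b ord0 1 = b.
Proof. by rewrite mxE. Qed.

Lemma ord2P (P : 'I_2 -> Prop) : P 0 -> P 1 -> forall i, P i.
Proof.
move=> P0 P1 [[|[|//]] i2].
  by rewrite (_ : Ordinal i2 = 0) //; apply/val_inj.
by rewrite (_ : Ordinal i2 = 1) //; apply/val_inj.
Qed.

Lemma nonneg_vec2 (a b : R) : 0 <= a -> 0 <= b -> nonneg_orthant (vec2 a b).
Proof. by move=> a0 b0; apply: ord2P; rewrite ?vec2_0 ?vec2_1. Qed.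

Lemma pos_vec2 (a b : R) : 0 < a -> 0 < b -> pos_orthant (vec2 a b).
Proof. by move=> a0 b0; apply: ord2P; rewrite ?vec2_0 ?vec2_1. Qed.

Lemma Phi_lt_r phi (a b b' : R) : Phi_class phi -> 0 <= a -> 0 <= b -> b < b' ->
  phi (vec2 a b) < phi (vec2 a b').
Proof.
move=> [_ _ inc _ _] a0 b0 bb'; apply: (inc _ _ 1).
- exact: nonneg_vec2.
- by apply: nonneg_vec2 => //; lra.
- by apply: ord2P => // _; rewrite !vec2_0.
- by rewrite !vec2_1.
Qed.

Lemma Phi_lt_l phi (a a' b : R) : Phi_class phi -> 0 <= a -> 0 <= b -> a < a' ->
  phi (vec2 a b) < phi (vec2 a' b).
Proof.
move=> [_ _ inc _ _] a0 b0 aa'; apply: (inc _ _ 0).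
- exact: nonneg_vec2.
- by apply: nonneg_vec2 => //; lra.
- by apply: ord2P => // _; rewrite !vec2_1.
- by rewrite !vec2_0.
Qed.

(** If l' < l, both arguments strictly decrease, and so would the value, although it is 1 in both
    cases. *)
Lemma Phi_monotone phi : Phi_class phi -> monotone_gauge phi.
Proof.
move=> Pphi a b a' b' l l' a0 b0 l0 l0' aa' bb' h h'.
rewrite leNgt; apply/negP => ll.
have lta : l' / a' < l / a.
  apply: (@lt_le_trans _ _ (l / a')).
    by rewrite ltr_pM2r // invr_gt0; lra.
  by rewrite ler_pM2l // lef_pV2 // posrE; lra.
have ltb : l' / b' < l / b.
  apply: (@lt_le_trans _ _ (l / b')).
    by rewrite ltr_pM2r // invr_gt0; lra.
  by rewrite ler_pM2l // lef_pV2 // posrE; lra.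
have p1 : 0 <= l' / a' by apply: divr_ge0; lra.
have p2 : 0 <= l' / b' by apply: divr_ge0; lra.
have := Phi_lt_l Pphi p1 p2 lta.
have := Phi_lt_r Pphi (le_trans p1 (ltW lta)) p2 ltb.
by rewrite h h'; lra.
Qed.

Lemma vec2_continuous (f g : R -> R) (t : R) :
  {for t, continuous f} -> {for t, continuous g} ->
  {for t, continuous (fun s => vec2 (f s) (g s))}.
Proof.
move=> cf cg; apply/cvg_ballP => e e0.
have /cvgrPdist_lt /(_ _ e0) nf := cf; have /cvgrPdist_lt /(_ _ e0) ng := cg.
near=> s; apply/rV_ballP => //; apply: ord2P; rewrite ?vec2_0 ?vec2_1.
  by near: s.
by near: s.
Unshelve. all: by end_near. Qed.

(** Intermediate value theorem on [0, a]: the value is 0 at 0, and at a the first argument is 1 and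
    the second positive, so the value exceeds [phi] at the first basis vector, which is 1. *)
Lemma Phi_solvable phi : Phi_class phi -> solvable_gauge phi.
Proof.
move=> Pphi a b a0 b0; have [_ /subspace_continuousP cphi _ phi0 phi1] := Pphi.
pose f t := phi (vec2 (t / a) (t / b)).
have cf : {within `[0, a], continuous f}.
  apply/subspace_continuousP => t; rewrite /= in_itv /= => /andP[t0 _].
  have nt (s : R) : 0 <= s -> nonneg_orthant (vec2 (s / a) (s / b)).
    by move=> s0; apply: nonneg_vec2; apply: divr_ge0; lra.
  have cv : {for (t : R), continuous (fun s : R => vec2 (s / a) (s / b))}.
    by apply: vec2_continuous; apply: continuousM;
      [exact: cvg_id|exact: cst_continuous|exact: cvg_id|exact: cst_continuous].
  have := cphi _ (nt _ t0); apply: cvg_trans => A /=.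
  rewrite !nbhs_simpl /= => /cv; rewrite !nbhs_simpl /= => tA.
  rewrite /within /=; apply: filterS tA => s /= sA.
  by rewrite in_itv /= => /andP[s0 _]; apply: sA; exact: nt.
have f0 : f 0 = 0.
  rewrite /f !mul0r -phi0; congr phi.
  by apply/rowP; apply: ord2P; rewrite ?vec2_0 ?vec2_1 mxE.
have fa : 1 < f a.
  rewrite -(phi1 0) /f divff ?gt_eqF //.
  rewrite (_ : delta_mx ord0 0 = vec2 1 0).
    by apply: Phi_lt_r => //; rewrite divr_gt0.
  by apply/rowP; apply: ord2P; rewrite ?vec2_0 ?vec2_1 mxE.
have [|t] := IVT (v := 1) (ltW a0) cf.
  by rewrite f0 ge_min ler01 /= le_max (ltW fa) orbT.
rewrite in_itv /= => /andP[t0 _] ft; exists t => //.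
rewrite lt_def t0 andbT; apply/eqP => tE; move: ft; rewrite tE f0 => /esym/eqP.
by rewrite oner_eq0.
Qed.

(** Passing to reciprocals of the radii and of the solution turns the equation for [phi] into one
    for [psi]. Solvability carries over, and so does monotonicity, since the order is reversed on
    both sides. *)
Lemma Psi_vec2E phi psi (a b l : R) :
  (forall x, pos_orthant x -> psi x = phi (map_mx GRing.inv x)) ->
  0 < a -> 0 < b -> 0 < l ->
  phi (vec2 (l / a) (l / b)) = psi (vec2 (l^-1 / a^-1) (l^-1 / b^-1)).
Proof.
move=> psiE a0 b0 l0; rewrite psiE.
  by congr phi; apply/rowP; apply: ord2P; rewrite ?vec2_0 ?vec2_1 mxE
    ?vec2_0 ?vec2_1 invf_div invrK mulrC.
by apply: pos_vec2; rewrite divr_gt0 ?invr_gt0.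
Qed.

Lemma Psi_solvable phi : Psi_class phi -> solvable_gauge phi.
Proof.
move=> [_ [psi Ppsi psiE]] a b a0 b0.
have a0' : 0 < a^-1 by rewrite invr_gt0.
have b0' : 0 < b^-1 by rewrite invr_gt0.
have [l l0 lE] := Phi_solvable Ppsi a0' b0'; exists l^-1; first by rewrite invr_gt0.
by rewrite (Psi_vec2E psiE) ?invr_gt0 // (invrK l).
Qed.

Lemma Psi_monotone phi : Psi_class phi -> monotone_gauge phi.
Proof.
move=> [_ [psi Ppsi psiE]] a b a' b' l l' a0 b0 l0 l0' aa' bb'.
have a0' : 0 < a' by lra.
have b0' : 0 < b' by lra.
rewrite !(Psi_vec2E psiE) // => h h'.
rewrite -lef_pV2 ?posrE //.
by apply: (Phi_monotone Ppsi _ _ _ _ _ _ h' h); rewrite ?invr_gt0 ?lef_pV2 ?posrE.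
Qed.

End orlicz_gauge.

(** * Existence of the Orlicz radial sum, dilates and the volume inequality *)

Section orlicz_sum.
Context {R : realType} (n : nat) (n_gt0 : (0 < n)%N).
Variable phi : 'rV[R]_2 -> R.
Hypotheses (sphi : solvable_gauge phi) (mphi : monotone_gauge phi).
Implicit Types (K L : set 'rV[R]_n) (x : 'rV[R]_n).

Lemma gauge_solution : exists lam : R -> R -> R, forall a b, 0 < a -> 0 < b ->
  0 < lam a b /\ phi (vec2 (lam a b / a) (lam a b / b)) = 1.
Proof.
have H (ab : R * R) : exists l, 0 < ab.1 -> 0 < ab.2 ->
    0 < l /\ phi (vec2 (l / ab.1) (l / ab.2)) = 1.
  have [a0|a0] := ltP 0 ab.1; last by exists 0; lra.
  have [b0|b0] := ltP 0 ab.2; last by exists 0; lra.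
  by have [l l0 lE] := sphi a0 b0; exists l.
have [lam lamP] := choice H.
by exists (fun a b => lam (a, b)) => a b a0 b0; exact: (lamP (a, b)).
Qed.

(** The gauge equation is solved in each direction. Continuity of the resulting radial function
    comes from monotonicity and homogeneity of the solution, not from continuity of [phi]. *)
Lemma orlicz_radial_sum_exists K L : star_body K -> star_body L ->
  exists M, is_orlicz_radial_sum phi K L M.
Proof.
move=> [_ _ cK K0] [_ _ cL L0]; have [lam lamP] := gauge_solution.
have scaled (s a b : R) : 0 < s -> 0 < a -> 0 < b ->
    phi (vec2 (s * lam a b / (s * a)) (s * lam a b / (s * b))) = 1.
  move=> s0 a0 b0; have sn0 := lt0r_neq0 s0.
  by rewrite -!mulf_div divff // !mul1r (lamP _ _ a0 b0).2.
pose r u := lam (radial K u) (radial L u).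
have r0 u : unit_sphere u -> 0 < r u.
  by move=> u1; exact: (lamP _ _ (K0 _ u1) (L0 _ u1)).1.
have cr : {within @unit_sphere R n, continuous r}.
  apply/subspace_continuousP => u u1.
  have Ku := K0 _ u1; have Lu := L0 _ u1; have ru := r0 _ u1.
  apply/cvgrPdist_le => e e0.
  (* The bound 1/2 keeps 1 - d positive; the bound e / r u makes a relative change of d an absolute
     change of at most e. *)
  pose d := Num.min 2^-1 (e / r u).
  have d0 : 0 < d by rewrite lt_min divr_gt0 //; lra.
  have d1 : d <= 2^-1 by rewrite ge_min lexx.
  have dr : d * r u <= e by rewrite -ler_pdivlMr // ge_min lexx orbT.
  (* The solution is nondecreasing and 1-homogeneous in the two radii, so
     changing both radii by a factor within [1 - d, 1 + d] changes it by such
     a factor as well. *)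
  have near_rad T : {within @unit_sphere R n, continuous (radial T)} ->
      0 < radial T u -> \forall v \near within (@unit_sphere R n) (nbhs u),
      (1 - d) * radial T u <= radial T v <= (1 + d) * radial T u.
    move=> /subspace_continuousP /(_ u u1) /cvgrPdist_le cT T0.
    have := cT _ (mulr_gt0 d0 T0); apply: filterS => v Tv.
    have {Tv} : `|radial T u - radial T v| <= d * radial T u by exact: Tv.
    by rewrite ler_norml => /andP[? ?]; apply/andP; split; lra.
  have nK := near_rad K cK Ku; have nL := near_rad L cL Lu.
  have nS : \forall v \near within (@unit_sphere R n) (nbhs u), unit_sphere v.
    exact: withinT.
  near=> v.
  have v1 : unit_sphere v by near: v.
  have /andP[Klo Khi] : (1 - d) * radial K u <= radial K v <= (1 + d) * radial K u.
    by near: v.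
  have /andP[Llo Lhi] : (1 - d) * radial L u <= radial L v <= (1 + d) * radial L u.
    by near: v.
  have lv := (lamP _ _ (K0 _ v1) (L0 _ v1)).2.
  have p0 : 0 < 1 + d by lra.
  have m0 : 0 < 1 - d by lra.
  have hi : r v <= (1 + d) * r u.
    apply: (mphi _ _ _ _ Khi Lhi lv (scaled _ _ _ p0 Ku Lu));
      by rewrite ?K0 ?L0 ?r0 ?mulr_gt0.
  have lo : (1 - d) * r u <= r v.
    apply: (mphi _ _ _ _ Klo Llo (scaled _ _ _ m0 Ku Lu) lv);
      by rewrite ?mulr_gt0 ?r0.
  have : `|r u - r v| <= e by rewrite ler_norml; apply/andP; split; lra.
  exact.
exists (star_of r); split; first exact: star_body_star_of.
move=> u u1; rewrite radial_star_of ?r0 //.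
exact: (lamP _ _ (K0 _ u1) (L0 _ u1)).2.
Unshelve. all: by end_near. Qed.

Lemma orlicz_radial_sumP K L : star_body K -> star_body L ->
  is_orlicz_radial_sum phi K L (orlicz_radial_sum phi K L).
Proof.
by move=> sK sL; apply: xgetPex; exact: orlicz_radial_sum_exists.
Qed.

Definition F2 (a b : R) := F_of n phi (vec2 a b).

Lemma powR_inv_root (a : R) : 0 < a -> (a ^+ n) `^ (- n%:R^-1) = a^-1.
Proof.
move=> a0; rewrite powRN -powR_mulrn ?ltW // -powRrM divff ?powRr1 ?ltW //.
by rewrite pnatr_eq0 -lt0n.
Qed.

(** The defining equation of the sum in the direction of x: the exponent -1/n undoes the n-th power
    in [ratio] and inverts the quotient. *)
Lemma F2_ratio K L M x : star_body K -> star_body L ->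
  is_orlicz_radial_sum phi K L M -> x != 0 ->
  F2 (ratio K M x) (ratio L M x) = 1.
Proof.
move=> sK sL [sM ME] x0; rewrite /F2 /F_of vec2_0 vec2_1.
rewrite !powR_inv_root ?divr_gt0 ?rad_gt0 // !invf_div.
exact: ME (dir_unit_sphere x0).
Qed.

Lemma F2_quotient (a b m : R) : 0 < a -> 0 < b -> 0 < m ->
  phi (vec2 ((m / a) `^ n%:R^-1) ((m / b) `^ n%:R^-1)) = F2 (a / m) (b / m).
Proof.
move=> a0 b0 m0; rewrite /F2 /F_of vec2_0 vec2_1.
have inv_powR (c : R) : 0 < c -> (m / c) `^ n%:R^-1 = (c / m) `^ (- n%:R^-1).
  move=> c0; have cm0 : 0 <= c / m by rewrite ltW // divr_gt0.
  by rewrite -(invf_div c m) -(powR_inv1 cm0) -powRrM mulN1r.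
by rewrite !inv_powR.
Qed.

Lemma radial_dilate K L (l : R) u : star_body K -> star_body L -> 0 < l ->
  L = [set l *: x | x in K] -> unit_sphere u -> radial L u = l * radial K u.
Proof.
move=> sK sL l0 LE u1; have u0 := unit_sphere_neq0 u1.
(* The two radii are compared through the positive numbers t that lie below them, that is, through
   membership of t u in the bodies. *)
have key t : 0 < t -> t <= radial L u <-> t <= l * radial K u.
  move=> t0; have tu0 : t *: u != 0 by rewrite scaler_eq0 negb_or u0 gt_eqF.
  have := star_bodyP sL tu0; rewrite radZ // radE // (enormZ _ (ltW t0)) u1 mulr1.
  move=> <-; rewrite LE /=.
  have tl0 : 0 < t / l by rewrite divr_gt0.
  have tlu0 : (t / l) *: u != 0 by rewrite scaler_eq0 negb_or u0 gt_eqF.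
  have := star_bodyP sK tlu0; rewrite radZ // radE // (enormZ _ (ltW tl0)) u1 mulr1.
  rewrite ler_pdivrMr // (mulrC _ l) => <-; split.
    move=> [x Kx xE]; suff -> : (t / l) *: u = x by [].
    by rewrite mulrC -scalerA -xE scalerA mulVf ?scale1r // gt_eqF.
  by move=> Ktu; exists ((t / l) *: u) => //; rewrite scalerA mulrC divfK // gt_eqF.
have K0 := rad_gt0 sK u0; have L0 := rad_gt0 sL u0.
rewrite !radE // in K0 L0.
apply/eqP; rewrite eq_le; apply/andP; split; first exact/(key _ L0).
by apply/key => //; exact: mulr_gt0.
Qed.

Lemma dilates_radial K L (s : R) : star_body K -> star_body L -> 0 < s ->
  (forall x, x != 0 -> rad L x = s * rad K x) -> dilates K L.
Proof.
move=> sK sL s0 LK; exists s => //.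
have sn0 := lt0r_neq0 s0.
apply/seteqP; split => x.
  move=> Lx; exists (s^-1 *: x); last by rewrite scalerA divff // scale1r.
  have [->|x0] := eqVneq x 0; first by rewrite scaler0; exact: star_body0.
  have sx0 : s^-1 *: x != 0 by rewrite scaler_eq0 negb_or x0 invr_eq0 sn0.
  apply/star_bodyP => //; rewrite radZ ?invr_gt0 // enormZ ?invr_ge0 ?(ltW s0) //.
  by rewrite ler_pdivrMl // -LK //; apply/star_bodyP.
move=> [y Ky <-]; have [->|y0] := eqVneq y 0.
  by rewrite scaler0; exact: star_body0.
have sy0 : s *: y != 0 by rewrite scaler_eq0 negb_or y0 sn0.
apply/star_bodyP => //; rewrite radZ // (enormZ _ (ltW s0)) LK // ler_pM2l //.
exact/star_bodyP.
Qed.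

(** In every direction [rad M / rad K] solves the gauge equation with radii 1 and l; the solution is
    unique by monotonicity, hence independent of the direction. *)
Lemma dilates_const_ratio K L M x y : star_body K -> star_body L ->
  is_orlicz_radial_sum phi K L M -> dilates K L -> x != 0 -> y != 0 ->
  ratio K M x = ratio K M y /\ ratio L M x = ratio L M y.
Proof.
move=> sK sL [sM ME] [l l0 LE] x0 y0.
have LK z : z != 0 -> rad L z = l * rad K z.
  by move=> z0; apply: radial_dilate => //; exact: dir_unit_sphere.
have Mz z : z != 0 -> 0 < rad M z / rad K z /\
    phi (vec2 (rad M z / rad K z / 1) (rad M z / rad K z / l)) = 1.
  move=> z0; split; first by rewrite divr_gt0 ?rad_gt0.
  have := ME _ (dir_unit_sphere z0); rewrite -/(rad M z) -/(rad K z) -/(rad L z).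
  by rewrite LK // invfM mulrA divr1 mulrAC.
have [mx ex] := Mz _ x0; have [my ey] := Mz _ y0.
have E : rad M x / rad K x = rad M y / rad K y.
  apply/eqP; rewrite eq_le.
  by rewrite (mphi ltr01 l0 mx my (lexx _) (lexx _) ex ey)
    (mphi ltr01 l0 my mx (lexx _) (lexx _) ey ex).
have E' : rad K x / rad M x = rad K y / rad M y.
  by rewrite -invf_div E invf_div.
by rewrite /ratio !LK // -!mulrA E'.
Qed.

(** Dividing the two constants shows that the n-th power of [rad L / rad K] is constant, and
    positive n-th roots are unique. *)
Lemma const_ratio_dilates K L M (p q : R) : star_body K -> star_body L ->
  star_body M -> (forall x, x != 0 -> ratio K M x = p /\ ratio L M x = q) ->
  dilates K L.
Proof.
move=> sK sL sM H.
have [u /unit_sphere_neq0 u0] := unit_sphere_nonempty (R := R) n_gt0.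
have LKE x : x != 0 -> (rad L x / rad K x) ^+ n = q / p.
  move=> x0; have [<- <-] := H _ x0.
  rewrite -expr_div_n; congr (_ ^+ _).
  by rewrite invf_div mulrA divfK // gt_eqF // rad_gt0.
apply: (@dilates_radial _ _ (rad L u / rad K u)) => //.
  by rewrite divr_gt0 ?rad_gt0.
move=> x x0; rewrite -[LHS](divfK (lt0r_neq0 (rad_gt0 sK x0))); congr (_ * _).
apply/eqP; rewrite -(eqrXn2 n_gt0) ?LKE //; apply: divr_ge0; apply: ltW;
  exact: rad_gt0.
Qed.

(* [sg] is 1 in the convex and -1 in the concave case. *)
Lemma volume_orlicz_radial_sum (sg : R) K L (g := fun a b => sg * F2 a b) :
  convex2 g -> star_body K -> star_body L ->
  let M := orlicz_radial_sum phi K L in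
  let v := phi (vec2 ((volume M / volume K) `^ n%:R^-1)
                     ((volume M / volume L) `^ n%:R^-1)) in
  sg * v <= sg /\ (strictly_convex2 g -> v = 1 <-> dilates K L).
Proof.
move=> cg sK sL M; have MP := orlicz_radial_sumP sK sL; have [sM _] := MP.
have gc x : x != 0 -> g (ratio K M x) (ratio L M x) = sg.
  by move=> x0; rewrite /g F2_ratio // mulr1.
have vK := star_body_volume_gt0 n_gt0 sK.
have vL := star_body_volume_gt0 n_gt0 sL.
have vM := star_body_volume_gt0 n_gt0 sM.
rewrite /= F2_quotient //; split; first exact: (jensen_volume n_gt0 sK sL sM gc cg).
move=> scg; split => [vE|dKL].
  apply: (const_ratio_dilates sK sL sM).
  apply: (jensen_volume_eq n_gt0 sK sL sM gc cg scg).
  by rewrite /g vE mulr1.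
(* For dilates the ratios are constant, so the volume quotients equal the ratios at a single u,
   where F is 1 by definition of the sum. *)
have [u /unit_sphere_neq0 u0] := unit_sphere_nonempty (R := R) n_gt0.
rewrite (volume_const_ratio n_gt0 sK sM (a := ratio K M u)); last first.
  by move=> x x0; exact: (dilates_const_ratio sK sL MP dKL x0 u0).1.
rewrite (volume_const_ratio n_gt0 sL sM (a := ratio L M u)); last first.
  by move=> x x0; exact: (dilates_const_ratio sK sL MP dKL x0 u0).2.
exact: F2_ratio.
Qed.

End orlicz_sum.

(** * Convexity of F as a function of two real variables *)

Section convexity_of_F2.
Local Open Scope convex_scope.
Context {R : realType} (n : nat).
Variable phi : 'rV[R]_2 -> R.

Lemma vec2_conv (t : {i01 R}) (a b c d : R) :
  (vec2 a b : convex_lmodType 'rV[R]_2) <| t |> vec2 c d =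
  vec2 (t%:num * a + (1 - t%:num) * c) (t%:num * b + (1 - t%:num) * d).
Proof.
by apply/rowP; apply: ord2P; rewrite ?vec2_0 ?vec2_1 !mxE /=.
Qed.

Lemma i01_of (t : R) : 0 < t < 1 -> exists s : {i01 R}, s%:num = t.
Proof. by move=> /andP[t0 t1]; exists (Itv01 (ltW t0) (ltW t1)). Qed.

Lemma mem_pos_vec2 (a b : R) : 0 < a -> 0 < b ->
  vec2 a b \in (@pos_orthant R 2 : set (convex_lmodType 'rV[R]_2)).
Proof. by move=> a0 b0; rewrite inE; exact: pos_vec2. Qed.

Lemma vec2_neq (a b c d : R) : (a, b) != (c, d) -> vec2 a b != vec2 c d.
Proof.
apply: contra => /eqP /rowP H; have := H 0; have := H 1.
by rewrite !vec2_0 !vec2_1 => -> ->.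
Qed.

(** The factor 1 is the sign [sg] of [volume_orlicz_radial_sum]; the concave counterparts have
    -1. *)
Lemma convex2_F2 : convex_function (@pos_orthant R 2) (F_of n phi) ->
  convex2 (fun a b => 1 * F2 n phi a b).
Proof.
move=> cF t a b c d /i01_of[s <-] a0 b0 c0 d0; rewrite !mul1r.
have := cF s _ _ (mem_pos_vec2 a0 b0) (mem_pos_vec2 c0 d0).
by rewrite vec2_conv convRE.
Qed.

Lemma strictly_convex2_F2 :
  strictly_convex_function (@pos_orthant R 2) (F_of n phi) ->
  strictly_convex2 (fun a b => 1 * F2 n phi a b).
Proof.
move=> cF t a b c d t01 a0 b0 c0 d0 /vec2_neq ne; rewrite !mul1r.
have [s sE] := i01_of t01; rewrite -sE in t01 *.
have := cF s t01 _ _ (mem_pos_vec2 a0 b0) (mem_pos_vec2 c0 d0) ne.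
by rewrite vec2_conv convRE.
Qed.

Lemma concave_convex2_F2 : concave_function (@pos_orthant R 2) (F_of n phi) ->
  convex2 (fun a b => -1 * F2 n phi a b).
Proof.
move=> cF t a b c d /i01_of[s <-] a0 b0 c0 d0.
have := cF s _ _ (mem_pos_vec2 a0 b0) (mem_pos_vec2 c0 d0).
by rewrite vec2_conv convRE !mulN1r !mulrN -opprD lerN2.
Qed.

Lemma strictly_concave_convex2_F2 :
  strictly_concave_function (@pos_orthant R 2) (F_of n phi) ->
  strictly_convex2 (fun a b => -1 * F2 n phi a b).
Proof.
move=> cF t a b c d t01 a0 b0 c0 d0 /vec2_neq ne.
have [s sE] := i01_of t01; rewrite -sE in t01 *.
have := cF s t01 _ _ (mem_pos_vec2 a0 b0) (mem_pos_vec2 c0 d0) ne.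
by rewrite vec2_conv convRE !mulN1r !mulrN -opprD ltrN2.
Qed.

End convexity_of_F2.

Theorem theorem2p1 (R : realType) (n : nat) (n_gt0 : (0 < n)%N)
    (phi : 'rV[R]_2 -> R) (phiP : Phi_class phi \/ Psi_class phi) :
  (convex_function (@pos_orthant R 2) (F_of n phi) ->
    (forall K L : set 'rV[R]_n, star_body K -> star_body L ->
      phi (vec2
        ((volume (orlicz_radial_sum phi K L) / volume K) `^ (n%:R^-1))
        ((volume (orlicz_radial_sum phi K L) / volume L) `^ (n%:R^-1))) <= 1) /\
    (strictly_convex_function (@pos_orthant R 2) (F_of n phi) ->
      forall K L : set 'rV[R]_n, star_body K -> star_body L ->
        (phi (vec2
          ((volume (orlicz_radial_sum phi K L) / volume K) `^ (n%:R^-1))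
          ((volume (orlicz_radial_sum phi K L) / volume L) `^ (n%:R^-1))) = 1
        <-> dilates K L))) /\
  (concave_function (@pos_orthant R 2) (F_of n phi) ->
    (forall K L : set 'rV[R]_n, star_body K -> star_body L ->
      1 <= phi (vec2
        ((volume (orlicz_radial_sum phi K L) / volume K) `^ (n%:R^-1))
        ((volume (orlicz_radial_sum phi K L) / volume L) `^ (n%:R^-1)))) /\
    (strictly_concave_function (@pos_orthant R 2) (F_of n phi) ->
      forall K L : set 'rV[R]_n, star_body K -> star_body L ->
        (phi (vec2
          ((volume (orlicz_radial_sum phi K L) / volume K) `^ (n%:R^-1))
          ((volume (orlicz_radial_sum phi K L) / volume L) `^ (n%:R^-1))) = 1
        <-> dilates K L))).
Proof.
have sphi : solvable_gauge phi.
  by case: phiP => [/Phi_solvable|/Psi_solvable].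
have mphi : monotone_gauge phi.
  by case: phiP => [/Phi_monotone|/Psi_monotone].
split => [/convex2_F2 cF|/concave_convex2_F2 cF]; split.
- move=> K L sK sL.
  by have [] := volume_orlicz_radial_sum n_gt0 sphi mphi cF sK sL; rewrite mul1r.
- move=> /strictly_convex2_F2 scF K L sK sL.
  exact: (volume_orlicz_radial_sum n_gt0 sphi mphi cF sK sL).2.
- move=> K L sK sL.
  have [] := volume_orlicz_radial_sum n_gt0 sphi mphi cF sK sL.
  by rewrite mulN1r lerN2.
- move=> /strictly_concave_convex2_F2 scF K L sK sL.
  exact: (volume_orlicz_radial_sum n_gt0 sphi mphi cF sK sL).2.
Qed.
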